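(* Let $L=a(x)\frac{d^2}{dx^2}+b(x)\frac{d}{dx}$ on $(-M,N)$ with $a>0$, with speed measure $\mu$, scale measure $\nu$, and principal eigenvalues $\lambda^{\mathrm{DD}},\lambda^{\mathrm{NN}}$ as in the context. Define $$(\bar\kappa^{\mathrm{DD}})^{-1}=\inf_{x<y}\Big(\nu(-M,x)^{-1}+\nu[y,N)^{-1}\Big)\bigg\{\mu(x,y)+\int_{-M}^x\mu(dz)\Big[1-\frac{\nu(z,x)}{\nu(-M,x)}\Big]^2+\int_y^N\mu(dz)\Big[1-\frac{\nu(y,z)}{\nu(y,N)}\Big]^2\bigg\}^{-1},$$ $$(\bar\kappa^{\mathrm{NN}})^{-1}=\inf_{x<y}\Big(\mu(-M,x)^{-1}+\mu[y,N)^{-1}\Big)\bigg\{\nu(x,y)+\int_{-M}^x\nu(dz)\Big[1-\frac{\mu(z,x)}{\mu(-M,x)}\Big]^2+\int_y^N\nu(dz)\Big[1-\frac{\mu(y,z)}{\mu(y,N)}\Big]^2\bigg\}^{-1},$$ $$(\kappa^{\mathrm{DD}})^{-1}=\inf_{x<y}\big[\nu(-M,x)^{-1}+\nu(y,N)^{-1}\big]\mu(x,y)^{-1},$$ $$(\kappa^{\mathrm{NN}})^{-1}=\inf_{x<y}\big[\mu(-M,x)^{-1}+\mu(y,N)^{-1}\big]\nu(x,y)^{-1},$$ the infima being over $-M<x<y<N$. Then $$\lambda^{\mathrm{DD}}\le(\bar\kappa^{\mathrm{DD}})^{-1}\le(\kappa^{\mathrm{DD}})^{-1}\qquad\text{and}\qquad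 \lambda^{\mathrm{NN}}\le(\bar\kappa^{\mathrm{NN}})^{-1}\le(\kappa^{\mathrm{NN}})^{-1}.$$
   Context: Let $M,N\in(0,\infty]$ and let $a>0$, $b$ be functions on $(-M,N)$. Fix a reference point $x_0\in(-M,N)$ and put $C(x)=\int_{x_0}^x\frac ba\,du$, $\mu(dx)=\frac{e^{C(x)}}{a(x)}dx$, $\nu(dx)=e^{-C(x)}dx$. For an interval, $\mu(x,y)$ and $\nu(x,y)$ denote the measures of $(x,y)$, and $\mu[y,N)$, $\nu[y,N)$ those of $[y,N)$. Convention: $1/\infty=0$; also a ratio with finite numerator and infinite denominator is $0$. $\|\cdot\|$ is the norm of $L^2(\mu)$, $\mu(f)=\int f\,d\mu$, $D(f)=\int_{-M}^N (f')^2e^{C}dx$, $\mathcal A(-M,N)$ is the set of absolutely continuous functions on $(-M,N)$, and $\mathcal A_0(-M,N)$ is the subset of functions with compact support. Then $$\lambda^{\mathrm{DD}}=\inf\{D(f): f\in\mathcal A_0(-M,N),\ \|f\|=1\},$$ $$\lambda^{\mathrm{NN}}=\inf\{D(f): f\in\mathcal A(-M,N),\ \mu(f)=0,\ \|f\|=1\}.$$ Standing assumptions: for the DD assertions, $\mu$ and $\nu$ are locally finite on $(-M,N)$; for the NN assertions, $a$ and $b$ are continuous on $(-M,N)$ and $\mu(-M,N)<\infty$. It is not assumed that $\nu(-M,N)<\infty$. *)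

(* Defs.v *)
From HB Require Import structures.
From mathcomp Require Export all_boot all_order all_algebra.
From mathcomp Require Export all_classical all_reals all_analysis.
Export Order.TTheory GRing.Theory Num.Theory.
Export numFieldNormedType.Exports.

Set Implicit Arguments.
Unset Strict Implicit.
Unset Printing Implicit Defensive.

Local Open Scope classical_set_scope.
Local Open Scope ring_scope.

(* Intervals of real numbers whose end points may be infinite. *)
Definition oo {R : realType} (u v : \bar R) : set R :=
  [set z : R | (u < z%:E)%E /\ (z%:E < v)%E].

Definition co {R : realType} (u v : \bar R) : set R :=
  [set z : R | (u <= z%:E)%E /\ (z%:E < v)%E].

(* C(x) is the oriented integral of b / a from x0 to x. *)
Definition Cfun {R : realType} (a b : R -> R) (x0 x : R) : R :=
  if x0 <= x then \int[lebesgue_measure]_(u in `[x0, x]) (b u / a u)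
  else - \int[lebesgue_measure]_(u in `[x, x0]) (b u / a u).

(* m(dx) = w(x) dx on D, and m vanishes outside D; m is then determined on
   all Borel sets. *)
Definition has_density {R : realType}
    (m : {measure set (measurableTypeR R) -> \bar R})
    (D : set R) (w : R -> R) : Prop :=
  forall A : set (measurableTypeR R), measurable A ->
    m A = (\int[lebesgue_measure]_(x in A `&` D) (w x)%:E)%E.

Definition speed_measure {R : realType} (M N : \bar R) (a b : R -> R) (x0 : R)
    (mu : {measure set (measurableTypeR R) -> \bar R}) : Prop :=
  has_density mu (oo (- M)%E N) (fun x => expR (Cfun a b x0 x) / a x).

Definition scale_measure {R : realType} (M N : \bar R) (a b : R -> R) (x0 : R)
    (nu : {measure set (measurableTypeR R) -> \bar R}) : Prop :=
  has_density nu (oo (- M)%E N) (fun x => expR (- Cfun a b x0 x)).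

Definition locally_finite_on {R : realType} (D : set R)
    (m : {measure set (measurableTypeR R) -> \bar R}) : Prop :=
  forall K : set R, compact K -> K `<=` D -> (m K < +oo)%E.

Definition absolutely_continuous {R : realType} (D : set R) (f : R -> R) :
    Prop :=
  forall e : R, 0 < e -> exists2 d : R, 0 < d &
    forall (n : nat) (u v : 'I_n -> R),
      (forall i, u i <= v i /\ `[u i, v i] `<=` D) ->
      trivIset [set: 'I_n] (fun i => `]u i, v i[%classic) ->
      \sum_(i < n) (v i - u i) < d ->
      \sum_(i < n) `|f (v i) - f (u i)| < e.

(* Functions on (-M, N) are represented by functions on R; their values
   outside (-M, N) are irrelevant to every notion below. Absolute continuity is
   uniform on (-M, N); local absolute continuity would give a larger class,
   hence formally smaller infima in lambdaDD and lambdaNN. *)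
Definition classA {R : realType} (M N : \bar R) : set (R -> R) :=
  [set f | absolutely_continuous (oo (- M)%E N) f].

Definition classA0 {R : realType} (M N : \bar R) : set (R -> R) :=
  [set f | classA M N f /\
    exists K : set R, [/\ compact K, K `<=` oo (- M)%E N &
      forall x, oo (- M)%E N x -> ~ K x -> f x = 0]].

(* An absolutely continuous f is differentiable almost everywhere, so the
   default value of f^`() elsewhere does not affect the integral. *)
Definition energy {R : realType} (M N : \bar R) (a b : R -> R) (x0 : R)
    (f : R -> R) : \bar R :=
  (\int[lebesgue_measure]_(x in oo (- M) N)
     (((f^`()%classic x) ^+ 2 * expR (Cfun a b x0 x))%R)%:E)%E.

Definition lambdaDD {R : realType} (M N : \bar R) (a b : R -> R) (x0 : R)
    (mu : {measure set (measurableTypeR R) -> \bar R}) : \bar R :=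
  ereal_inf [set energy M N a b x0 f | f in
    [set f | classA0 M N f /\ 'N[mu]_2%:E[EFin \o f]%E = 1%E]].

Definition lambdaNN {R : realType} (M N : \bar R) (a b : R -> R) (x0 : R)
    (mu : {measure set (measurableTypeR R) -> \bar R}) : \bar R :=
  ereal_inf [set energy M N a b x0 f | f in
    [set f | [/\ classA M N f, (\int[mu]_x (f x)%:E)%E = 0%E &
      'N[mu]_2%:E[EFin \o f]%E = 1%E]]].

Section kappa.
Local Open Scope ereal_scope.

(* The quantities (kappa-bar)^-1 and kappa^-1 are defined directly, as in the
   source. In the library +oo^-1 = 0 and 0 * +oo = 0, so that r / +oo = 0. The
   NN quantities are the DD ones with mu and nu exchanged. *)
Definition kappa_bar_inv {R : realType} (M N : \bar R)
    (mu nu : {measure set (measurableTypeR R) -> \bar R}) : \bar R :=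
  ereal_inf [set r | exists x y : R,
    [/\ - M < x%:E, (x < y)%R, y%:E < N &
      r = ((nu (oo (- M) x%:E))^-1 + (nu (co y%:E N))^-1) *
          (mu (oo x%:E y%:E)
           + \int[mu]_(z in oo (- M) x%:E)
               (1 - nu (oo z%:E x%:E) / nu (oo (- M) x%:E)) ^+ 2
           + \int[mu]_(z in oo y%:E N)
               (1 - nu (oo y%:E z%:E) / nu (oo y%:E N)) ^+ 2)^-1]].

Definition kappa_inv {R : realType} (M N : \bar R)
    (mu nu : {measure set (measurableTypeR R) -> \bar R}) : \bar R :=
  ereal_inf [set r | exists x y : R,
    [/\ - M < x%:E, (x < y)%R, y%:E < N &
      r = ((nu (oo (- M) x%:E))^-1 + (nu (oo y%:E N))^-1) *
          (mu (oo x%:E y%:E))^-1]].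

End kappa.

Definition kappaDD_bar_inv {R : realType} (M N : \bar R)
    (mu nu : {measure set (measurableTypeR R) -> \bar R}) : \bar R :=
  kappa_bar_inv M N mu nu.

Definition kappaNN_bar_inv {R : realType} (M N : \bar R)
    (mu nu : {measure set (measurableTypeR R) -> \bar R}) : \bar R :=
  kappa_bar_inv M N nu mu.

Definition kappaDD_inv {R : realType} (M N : \bar R)
    (mu nu : {measure set (measurableTypeR R) -> \bar R}) : \bar R :=
  kappa_inv M N mu nu.

Definition kappaNN_inv {R : realType} (M N : \bar R)
    (mu nu : {measure set (measurableTypeR R) -> \bar R}) : \bar R :=
  kappa_inv M N nu mu.

(* Main.v *)
Require Import Defs.
From mathcomp Require Import measurable_realfun ring.

(** The outer inequalities compare the two families of quotients: for the same
    x < y the bracket of the barred constant is mu(x, y) (or nu(x, y)) plus two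
    nonnegative integrals. The inner ones are proved with trial functions.

    For measures m and sets S1 to the left of x and S2 to the right of y, let
      T(z) = m(S1 meet ]-oo, z]) / m(S1) - m(S2 meet ]-oo, z]) / m(S2).
    This is [trapezoid]: it is 1 on [x, y], equals 1 - m(z, x) / m(S1) on S1 and
    1 - m(y, z) / m(S2) on S2, so that its square is the integrand in the bracket
    of the barred constants. Let w = e ^ (- C) be the density of nu.

    Dirichlet case. With m = nu, S1 = (s, x) and S2 = (y, t), where
    -M < s < x < y < t < N, the function T is supported in [s, t] and is the
    primitive of w (1_S1 / nu(S1) - 1_S2 / nu(S2)). Hence its energy is
    A = 1 / nu(S1) + 1 / nu(S2), while its squared norm is at least the bracket
    restricted to (s, t) ([lambdaDD_le]).

    Neumann case. With m = mu, S1 = (-M, x) and S2 = (y, N), the function T gives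
    the derivative of the trial function: f is the primitive of w T cut off
    outside [s, t], minus its mean. Cutting off makes f Lipschitz. Its energy E is
    the integral of T ^ 2 against nu over [s, t]. Integrating by parts (Tonelli,
    [tonelli_primitive]), the mean of f under mu conditioned on S2 exceeds its
    mean under mu conditioned on S1 by exactly E, and a function with such a gap
    has variance at least E ^ 2 / A, with A = 1 / mu(S1) + 1 / mu(S2)
    ([jensen_sq] on each side). The Rayleigh quotient is thus at most A / E
    ([lambdaNN_le]).

    In both cases lambda <= A / V for every V below the restricted bracket. When
    s and t tend to the end points, the restricted brackets increase to the whole
    bracket, by monotone convergence, and the A tend to the first factor of the
    barred constant ([le_kappa_bar]). Bounding lambda by real quotients before
    passing to the limit covers all the cases in which nu is infinite near an end
    point or the bracket is infinite. *)

Set Implicit Arguments.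
Unset Strict Implicit.
Set SsrOldRewriteGoalsOrder.

Local Open Scope classical_set_scope.
Local Open Scope ring_scope.

(** * Intervals and densities *)

Lemma open_oo {R : realType} (u v : \bar R) : open (oo u v).
Proof. by apply: openI; [exact: open_ereal_gt|exact: open_ereal_lt]. Qed.

Lemma measurable_oo {R : realType} (u v : \bar R) :
  measurable (oo u v : set (measurableTypeR R)).
Proof. by apply: open_measurable; exact: open_oo. Qed.

Lemma subset_itv_oo {R : realType} (u v : \bar R) (s t : R) :
  oo u v s -> oo u v t -> `[s, t] `<=` oo u v.
Proof.
move=> [us sv] [ut tv] z; rewrite /= in_itv/= => /andP[sz zt]; split.
  by rewrite (lt_le_trans us)// lee_fin.
by rewrite (le_lt_trans _ tv)// lee_fin.
Qed.

Lemma exhaust_left {R : realType} (u : \bar R) (x : R) : (u < x%:E)%E ->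
  exists s : nat -> R, [/\ nonincreasing_seq s,
    forall n, (u < (s n)%:E)%E /\ s n < x &
    forall z : R, (u < z%:E)%E -> exists n, s n < z].
Proof.
case: u => [r| |] //.
- rewrite lte_fin => rx; exists (fun n => r + (x - r) / n.+2%:R); split.
  + apply/nonincreasing_seqP => n; rewrite lerD2l ler_pM2l ?subr_gt0//.
    by rewrite lef_pV2 ?posrE ?ltr0n// ler_nat.
  + move=> n; rewrite lte_fin ltrDl divr_gt0 ?subr_gt0//; split=> //.
    rewrite -ltrBrDl gtr_pMr ?subr_gt0// invf_lt1 ?ltr0n//.
    by rewrite ltr1n.
  + move=> z; rewrite lte_fin => rz.
    have zr : 0 < z - r by rewrite subr_gt0.
    exists (Num.truncn ((x - r) / (z - r))).
    rewrite -ltrBrDl ltr_pdivrMr ?ltr0n// mulrC -ltr_pdivrMr//.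
    apply: lt_trans (truncnS_gt _) _.
    by rewrite ltr_nat.
- move=> _; exists (fun n => x - n.+1%:R); split.
  + by apply/nonincreasing_seqP => n; rewrite lerD2l lerN2 ler_nat.
  + by move=> n; rewrite ltNyr gtrBl ltr0n.
  + move=> z _; exists (Num.truncn (x - z)).
    by rewrite ltrBlDr -ltrBlDl; exact: truncnS_gt.
Qed.

Lemma exhaust_right {R : realType} (v : \bar R) (y : R) : (y%:E < v)%E ->
  exists s : nat -> R, [/\ nondecreasing_seq s,
    forall n, ((s n)%:E < v)%E /\ y < s n &
    forall z : R, (z%:E < v)%E -> exists n, z < s n].
Proof.
move=> yv; have : (- v < (- y)%:E)%E by rewrite EFinN lteN2.
move=> /exhaust_left[s [ns us ex]]; exists (fun n => - s n); split.
- by move=> m n mn; rewrite lerN2 ns.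
- by move=> n; have [] := us n; rewrite EFinN lteNl ltrNr.
- move=> z zv; have [|n nz] := ex (- z); first by rewrite EFinN lteN2.
  by exists n; rewrite ltrNr.
Qed.

Import HBNNSimple.

Section density.
Context {R : realType} (m : {measure set (measurableTypeR R) -> \bar R}).
Context (D : set R) (w : R -> R).
Hypotheses (mD : measurable D) (mw : measurable_fun D w).
Hypotheses (w_gt0 : forall z, D z -> 0 < w z) (m_w : has_density m D w).

Lemma density_set1 z : m [set z] = 0%E.
Proof. by rewrite m_w// (integral_Sset1 z)//; exact: subIsetl. Qed.

Lemma density_restrict A : measurable A -> m (A `&` D) = m A.
Proof.
by move=> mA; rewrite !m_w//; [rewrite -setIA setIid|exact: measurableI].
Qed.

(** Otherwise the positive density w would vanish almost everywhere on an
    interval of positive length. *)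
Lemma density_gt0 (s t : R) (A : set R) : measurable A -> s < t ->
  `]s, t[ `<=` A `&` D -> (0 < m A)%E.
Proof.
move=> mA st stAD; have stD : `]s, t[ `<=` D by move=> z /stAD[].
suff : (0 < m `]s, t[%classic)%E.
  move=> /lt_le_trans; apply; apply: le_measure; rewrite ?inE//.
  by move=> z /stAD[].
rewrite lt0e measure_ge0 andbT; apply/eqP; rewrite m_w// setIidl//.
have mst : measurable_fun `]s, t[ (EFin \o w).
  by apply/measurable_EFinP; exact: measurable_funS mw.
move=> w0; have /ae_eq_integral_abs : (\int[lebesgue_measure]_(x in `]s, t[)
    `|(EFin \o w) x| = 0)%E.
  rewrite -[RHS]w0; apply: eq_integral => z; rewrite inE => /stD/w_gt0 wz.
  by rewrite /= gtr0_norm.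
move=> /(_ (measurable_itv _) mst)[N [mN N0 wN]].
have : (lebesgue_measure (`]s, t[%classic : set R) <= lebesgue_measure N)%E.
  apply: le_measure; rewrite ?inE// => z stz; apply: wN => /=.
  move=> /(_ stz)[] wz; have := w_gt0 (stD z stz).
  by rewrite wz ltxx.
rewrite N0 lebesgue_measure_itv/= lte_fin st -EFinD lee_fin.
by rewrite leNgt subr_gt0 st.
Qed.

(** The integral of f against m is a supremum over simple functions below f, and
    each of these has the same integral against m and against w. *)
Lemma ge0_density_integral_le (A : set R) (f : R -> R) : measurable A ->
  measurable_fun A f -> (forall z, A z -> 0 <= f z) ->
  (\int[m]_(z in A) (f z)%:E <=
   \int[lebesgue_measure]_(z in A `&` D) (f z * w z)%:E)%E.
Proof.
move=> mA mf f0; rewrite ge0_integralE//.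
apply/ge_ereal_sup => _ [/= phi phif <-].
have mphi r : measurable (phi @^-1` [set r]) by [].
have mwD r : measurable_fun D
    (fun z => r%:E * (w z * \1_(phi @^-1` [set r]) z)%:E)%E.
  apply: measurable_funeM; apply/measurable_EFinP.
  apply: measurable_funM; first exact: mw.
  exact: (measurable_indic (mphi r)).
have phiE : sintegral m phi =
    (\int[lebesgue_measure]_(z in D) (phi z * w z)%:E)%E.
  rewrite sintegralE; transitivity (\sum_(r \in range phi)
    \int[lebesgue_measure]_(z in D)
      (r%:E * (w z * \1_(phi @^-1` [set r]) z)%:E))%E.
    apply: eq_fsbigr => r; rewrite inE => -[z0 _ <-].
    rewrite ge0_integralZl_EFin//; last 2 first.
    - by move=> z Dz; rewrite lee_fin mulr_ge0// ltW// w_gt0.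
    - apply/measurable_EFinP.
      apply: measurable_funM; first exact: mw.
      exact: (measurable_indic (mphi _)).
    congr (_ * _)%E; rewrite m_w// setIC integral_mkcondr.
    apply: eq_integral => z _; rewrite patchE indicE.
    by case: ifPn => _; rewrite ?mulr1 ?mulr0.
  rewrite -ge0_integral_fsum//; last first.
    move=> r z Dz; rewrite indicE; case: (boolP (z \in _)) => [|_].
      rewrite inE => /= <-; rewrite mulr1 -EFinM lee_fin mulr_ge0//.
      by rewrite ltW// w_gt0.
    by rewrite mulr0 mule0.
  apply: eq_integral => z _; rewrite (fsbigD1 (phi z))// indicE mem_set//.
  rewrite mulr1 -EFinM/= fsbig1 ?adde0// => r [_ /= /nesym rz].
  by rewrite indicE memNset// mulr0 mule0.
apply: (@le_trans _ _ (\int[lebesgue_measure]_(z in D) (phi z * w z)%:E)%E).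
  by rewrite -phiE.
have phiA z : ~ A z -> phi z = 0.
  move=> Az; apply/eqP; rewrite eq_le fun_ge0 andbT -lee_fin.
  by have := phif z; rewrite patchE memNset.
have -> : (\int[lebesgue_measure]_(z in D) (phi z * w z)%:E)%E =
    (\int[lebesgue_measure]_(z in A `&` D) (phi z * w z)%:E)%E.
  rewrite setIC [RHS]integral_mkcondr; apply: eq_integral => z _.
  rewrite patchE; case: ifPn => //; rewrite notin_setE => /phiA->.
  by rewrite mul0r.
apply: ge0_le_integral => //.
- exact: measurableI.
- by move=> z [_ Dz]; rewrite lee_fin mulr_ge0// ltW// w_gt0.
- apply/measurable_EFinP; apply: measurable_funM.
    exact: measurable_funTS.
  by apply: measurable_funS mw.
- apply/measurable_EFinP; apply: measurable_funM.
    by apply: measurable_funS mf.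
  by apply: measurable_funS mw.
- move=> z [Az Dz]; rewrite lee_fin ler_wpM2r//; first by rewrite ltW// w_gt0.
  by rewrite -lee_fin; have := phif z; rewrite patchE mem_set.
Qed.
End density.

(** * The scale density *)

Section drift_integral.
Context {R : realType} (M N : \bar R) (a b : R -> R) (x0 : R).
Local Notation D := (oo (- M)%E N).
Local Notation f := (fun u => b u / a u).
Hypotheses (Dx0 : D x0) (lif : locally_integrable D f).

Lemma locally_integrable_itv (s t : R) : D s -> D t ->
  lebesgue_measure.-integrable `[s, t] (EFin \o f).
Proof.
move=> Ds Dt; have [mf _ intf] := lif.
have stD : `[s, t] `<=` D by exact: subset_itv_oo.
apply/integrableP; split.
  apply/measurable_EFinP; apply: measurable_funS mf => //; exact: measurable_oo.
by apply: intf => //; exact: segment_compact.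
Qed.

Lemma oo_between (z : R) : D z ->
  exists s t : R, [/\ D s, D t, s < x0 /\ s < z & x0 < t /\ z < t].
Proof.
move=> Dz; have [Mz zN] := Dz; have [Mx xN] := Dx0.
have [s [_ hs _]] := @exhaust_left R (- M)%E (Order.min x0 z)
  (ltac:(rewrite /Order.min; case: ifP => _; [exact: Mx|exact: Mz])).
have [t [_ ht _]] := @exhaust_right R N (Order.max x0 z)
  (ltac:(rewrite /Order.max; case: ifP => _; [exact: zN|exact: xN])).
exists (s 0%N), (t 0%N); move: (hs 0%N) (ht 0%N) => [Ms].
rewrite lt_min => /andP[sx sz] [tN]; rewrite gt_max => /andP[xt zt].
split => //; split => //.
  by rewrite (lt_trans _ xN)// lte_fin.
by rewrite (lt_trans Mx)// lte_fin.
Qed.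

(** Near z the oriented integral is the difference of the values at the variable
    point and at x0 of one primitive, started to the left of z and x0. *)
Lemma continuous_Cfun (z : R) : D z -> {for z, continuous (Cfun a b x0)}.
Proof.
move=> Dz; have [s [t [Ds Dt [sx sz] [xt zt]]]] := oo_between Dz.
pose P x := parameterized_integral lebesgue_measure s x f.
have st : s < t by exact: lt_trans sz zt.
have CE : {in `[s, t], Cfun a b x0 =1 (fun x => P x - P x0)}.
  move=> x; rewrite in_itv/= => /andP[sx' xt']; rewrite /Cfun /P.
  have ist u : s <= u -> u <= t ->
      lebesgue_measure.-integrable `[s, u] (EFin \o f).
    move=> su ut; apply: integrableS (locally_integrable_itv Ds Dt) => //.
    by apply: subset_itvl; rewrite bnd_simp.
  rewrite /parameterized_integral; case: leP => [x0x|xx0].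
    rewrite Rintegral_itvB ?bnd_simp//; last 2 first.
    - exact: ist.
    - exact: ltW.
    rewrite Rintegral_itv_obnd_cbnd//; apply: integrableS (ist x _ _) => //.
    by apply: subset_itvr; rewrite bnd_simp ltW.
  apply/eqP; rewrite -opprB eqr_opp; apply/eqP.
  rewrite Rintegral_itvB ?bnd_simp//; last 2 first.
  - by apply: ist; exact: ltW.
  - exact: ltW.
  rewrite Rintegral_itv_obnd_cbnd//; apply: integrableS (ist x0 _ _) => //.
  - by apply: subset_itvr; rewrite bnd_simp.
  - exact: ltW.
  - exact: ltW.
have cP : {within `[s, t], continuous P}.
  apply: parameterized_integral_continuous; first exact: ltW.
  exact: locally_integrable_itv.
have zst : z \in `]s, t[ by rewrite in_itv/= sz zt.
have cPz : {for z, continuous P}.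
  exact: (within_continuous_continuous _ cP zst).
have nst : \forall x \near z, x \in `[s, t].
  near=> x; have : x \in `]s, t[ by near: x; exact: near_in_itvoo.
  exact: subset_itv_oo_cc.
have zst' : z \in `[s, t] by exact: nbhs_singleton nst.
rewrite /prop_for /continuous_at (CE z)//.
have cd : (P x - P x0) @[x --> z] --> P z - P x0 by apply: cvgB => //; exact: cvg_cst.
apply: cvg_trans cd.
apply: near_eq_cvg; near=> x; rewrite (CE x)//.
by near: x.
Unshelve. all: by end_near. Qed.

Definition scale_density (z : R) := expR (- Cfun a b x0 z).

Lemma scale_density_gt0 z : 0 < scale_density z. Proof. exact: expR_gt0. Qed.

Lemma scale_densityV z : expR (Cfun a b x0 z) = (scale_density z)^-1.
Proof. by rewrite /scale_density expRN invrK. Qed.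

Lemma continuous_scale_density (z : R) : D z -> {for z, continuous scale_density}.
Proof.
move=> Dz; apply: continuous_comp; last exact: continuous_expR.
by apply: cvgN; exact: continuous_Cfun.
Qed.

Lemma measurable_scale_density : measurable_fun D scale_density.
Proof.
apply: open_continuous_measurable_fun; first exact: open_oo.
by move=> z; rewrite inE => /continuous_scale_density.
Qed.

Lemma scale_density_bounded (s t : R) : D s -> D t ->
  exists K : R, forall z, s <= z <= t -> scale_density z <= K.
Proof.
move=> Ds Dt; have [st|ts] := leP s t; last first.
  exists 0 => z /andP[sz zt]; exfalso.
  by have := lt_le_trans ts sz; rewrite ltNge zt.
have [|c _ wc] := @EVT_max R scale_density s t st.
  apply: continuous_in_subspaceT => z; rewrite inE => stz.
  by apply: continuous_scale_density; apply: subset_itv_oo stz.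
by exists (scale_density c) => z stz; apply: wc; rewrite in_itv.
Qed.

Lemma measurable_scale_densityV : measurable_fun D (fun z => (scale_density z)^-1).
Proof.
rewrite (_ : (fun z => _) = (fun z => expR (Cfun a b x0 z))); last first.
  by apply/funext => z; rewrite scale_densityV.
apply: open_continuous_measurable_fun; first exact: open_oo.
move=> z; rewrite inE => Dz; apply: continuous_comp.
  exact: continuous_Cfun.
exact: continuous_expR.
Qed.

Lemma measurable_speed_density : measurable_fun D a -> (forall z, D z -> 0 < a z) ->
  measurable_fun D (fun x => expR (Cfun a b x0 x) / a x).
Proof.
move=> ma a0; apply: measurable_funM.
  by under eq_fun do rewrite scale_densityV; exact: measurable_scale_densityV.
have mp : measurable_fun D (fun x => a x `^ (-1)).
  rewrite (_ : (fun x => _) = (fun y => y `^ (-1)) \o a)//.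
  by apply: measurableT_comp ma.
apply: eq_measurable_fun mp => z; rewrite inE => Dz.
by rewrite powR_inv1// ltW// a0.
Qed.
End drift_integral.

(** * Primitives of bounded functions *)

Section ae_le.
Local Open Scope ereal_scope.
Context d (T : measurableType d) (R : realType).
Variables (mu : {measure set T -> \bar R}).
Import HBNNSimple.

(** The integral of f is a supremum over simple functions below f, and these are
    measurable even if f is not. This serves for a derivative that is known only
    almost everywhere. *)
Lemma ae_le_integral_nonmeasurable (D : set T) (f g : T -> \bar R) :
  measurable D -> (forall x, D x -> 0 <= f x) ->
  (forall x, D x -> 0 <= g x) -> measurable_fun D g ->
  {ae mu, forall x, D x -> f x <= g x} ->
  \int[mu]_(x in D) f x <= \int[mu]_(x in D) g x.
Proof.
move=> mD f0 g0 mg fg; rewrite ge0_integralE//.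
apply/ge_ereal_sup => _ [phi phif <-].
rewrite -integralT_nnsfun [leRHS]integral_mkcond.
apply: ae_ge0_le_integral => //.
- by move=> x _; rewrite lee_fin.
- exact/measurable_EFinP.
- by move=> x _; apply: erestrict_ge0.
- by apply/(measurable_restrictT _ _).1.
case: fg => E [mE E0 fgE]; exists E; split => // x /= phig.
apply: fgE => /= fgx; apply: phig => _; apply: le_trans (phif x) _.
by rewrite !patchE; case: ifPn => //; rewrite inE; exact: fgx.
Qed.
End ae_le.

Section primitive.
Context {R : realType} (h : R -> R) (K s t : R).
Hypotheses (mh : measurable_fun [set: R] h) (hK : forall z, `|h z| <= K).
Hypotheses (h_supp : forall z, ~ `[s, t]%classic z -> h z = 0).
Local Notation lambda := (@lebesgue_measure R).

Lemma primitive_integrable (A : set (measurableTypeR R)) : measurable A ->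
  lambda.-integrable A (EFin \o h).
Proof.
move=> mA; apply: (@integrableS _ _ _ _ setT) => //.
have -> : EFin \o h = (EFin \o h) \_ `[s, t].
  apply/funext => z; rewrite patchE; case: ifPn => //.
  by rewrite notin_setE => /h_supp/= ->.
rewrite -integrable_mkcond//.
apply: measurable_bounded_integrable => //.
- by apply: compact_finite_measure; exact: segment_compact.
- exact: measurable_funTS mh.
exists K; split; first exact: num_real.
by move=> x Kx z _ /=; rewrite (le_trans (hK z))// ltW.
Qed.

Definition primitive (z : R) := \int[lambda]_(u in `]-oo, z]) h u.

Lemma primitive_lipschitz (u v : R) : u <= v ->
  `|primitive v - primitive u| <= K * (v - u).
Proof.
move=> uv; rewrite /primitive Rintegral_itvB ?bnd_simp//; last first.
  exact: primitive_integrable.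
have mI : measurable (`]u, v]%classic : set (measurableTypeR R)) by [].
have intK : lambda.-integrable `]u, v] (EFin \o cst K).
  apply: measurable_bounded_integrable => //; last first.
    by exists `|K|; split=> [|x Kx z _ /=]; [exact: num_real|exact: ltW].
  by rewrite /= lebesgue_measure_itv/=; case: ifP; rewrite ?ltry.
have intI : lambda.-integrable `]u, v] (EFin \o h).
  exact: primitive_integrable.
apply: (le_trans (le_normr_Rintegral mI intI)).
apply: (@le_trans _ _ (\int[lambda]_(z in `]u, v]) (cst K z))).
  apply: le_Rintegral => //.
  exact/integrable_norm/primitive_integrable.
rewrite Rintegral_cst//= lebesgue_measure_itv/= lte_fin.
by move: uv; rewrite le_eqVlt => /predU1P[->|->]; rewrite ?ltxx ?subrr.
Qed.

Lemma primitive_AC (D : set R) (k c : R) :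
  absolutely_continuous D (fun z => k * (primitive z + c)).
Proof.
move=> e e0; have K0 : 0 <= `|k| * K by rewrite mulr_ge0// (le_trans _ (hK 0)).
exists (e / (`|k| * K + 1)) => [|n u v uv _ sd].
  by rewrite divr_gt0// ltr_wpDl.
apply: (@le_lt_trans _ _ (`|k| * K * \sum_(i < n) (v i - u i))).
  rewrite mulr_sumr; apply: ler_sum => i _.
  rewrite (_ : _ - _ = k * (primitive (v i) - primitive (u i))); last by ring.
  rewrite normrM -mulrA ler_wpM2l//.
  by apply: primitive_lipschitz; have [] := uv i.
have S0 : 0 <= \sum_(i < n) (v i - u i).
  by apply: sumr_ge0 => i _; rewrite subr_ge0; have [] := uv i.
apply: (@le_lt_trans _ _ ((`|k| * K + 1) * \sum_(i < n) (v i - u i))).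
  by rewrite ler_wpM2r// lerDl.
by rewrite mulrC -ltr_pdivlMr// ltr_wpDl.
Qed.

Lemma primitive_derive : {ae lambda, forall z, derivable primitive z 1 /\
  primitive^`()%classic z = h z}.
Proof.
apply: FTC1Ny => [y|]; first exact: primitive_integrable.
apply: open_integrable_locally; first exact: openT.
exact: primitive_integrable.
Qed.

Lemma primitive_derive_affine (k c : R) : {ae lambda, forall z,
  (fun u => k * (primitive u + c))^`()%classic z = k * h z}.
Proof.
have := primitive_derive; apply: filterS => [|z [dP Pz]].
  exact: (ae_filter_ringOfSetsType lambda).
have dP1 : is_derive z 1 primitive (h z).
  by apply: (DeriveDef dP); rewrite -Pz derive1E.
have dcP := is_deriveZ k (is_deriveD dP1 (is_derive_cst c z 1)).
by rewrite derive1E (@derive_val _ _ _ _ _ _ _ dcP) addr0.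
Qed.

Lemma primitive_bounded : exists B : R, forall z, `|primitive z| <= B.
Proof.
have intT : lambda.-integrable setT (EFin \o (fun u => `|h u|)).
  by apply: integrable_norm; exact: primitive_integrable.
exists (\int[lambda]_u `|h u|) => z.
have intz := primitive_integrable (measurable_itv `]-oo, z]).
apply: (le_trans (le_normr_Rintegral _ intz)) => //.
rewrite /Rintegral; apply: fine_le.
- apply: integrable_fin_num => //.
  exact: (integrableS _ _ _ intT).
- exact: integrable_fin_num intT.
apply: ge0_subset_integral => //.
by have /integrableP[] := intT.
Qed.

Lemma measurable_primitive : measurable_fun [set: R] primitive.
Proof.
apply: continuous_measurable_fun => z.
apply/cvgrPdist_le => /= e e0; have K0 : 0 <= K by exact: le_trans (hK 0).
have K1 : 0 < K + 1 by rewrite ltr_wpDl.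
have lip u v : `|primitive u - primitive v| <= K * `|u - v|.
  have [uv|/ltW vu] := leP u v.
    rewrite distrC [`|u - v|]distrC (ger0_norm (_ : 0 <= v - u)) ?subr_ge0//.
    by rewrite primitive_lipschitz.
  by rewrite (ger0_norm (_ : 0 <= u - v)) ?subr_ge0// primitive_lipschitz.
near=> x; apply: (le_trans (lip z x)).
apply: (@le_trans _ _ ((K + 1) * `|z - x|)); first by rewrite ler_wpM2r// lerDl.
rewrite mulrC -ler_pdivlMr//.
by near: x; apply: cvgr_dist_le => //; rewrite divr_gt0.
Unshelve. all: by end_near. Qed.

(** Almost everywhere the derivative of the primitive is h; on the remaining null
    set the derivative has an arbitrary value, which costs nothing. *)
Lemma energy_primitive_le (M N : \bar R) (a b : R -> R) (x0 k c : R) :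
  oo (- M)%E N x0 -> locally_integrable (oo (- M)%E N) (fun u => b u / a u) ->
  (energy M N a b x0 (fun z => k * (primitive z + c))%R <=
   \int[lambda]_(z in oo (- M)%E N) (((k * h z) ^+ 2 * (scale_density a b x0 z)^-1)%R)%:E)%E.
Proof.
move=> Dx0 lif; rewrite /energy.
have mD := @measurable_oo R (- M)%E N.
under eq_integral do rewrite scale_densityV.
have w0 z : 0 <= (scale_density a b x0 z)^-1 by rewrite invr_ge0 ltW// scale_density_gt0.
apply: ae_le_integral_nonmeasurable => //.
- by move=> z _; rewrite lee_fin mulr_ge0// sqr_ge0.
- by move=> z _; rewrite lee_fin mulr_ge0// sqr_ge0.
- apply/measurable_EFinP; apply: measurable_funM.
    apply: measurable_funTS; apply: measurable_funX.
    exact: measurable_funM.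
  exact: measurable_scale_densityV.
have := primitive_derive_affine k c; apply: filterS => [|z -> _].
  exact: (ae_filter_ringOfSetsType lambda).
exact: lexx.
Qed.
End primitive.

(** * Trapezoids *)

Section cdf.
Context {R : realType} (m : {measure set (measurableTypeR R) -> \bar R}).
Context (S : set (measurableTypeR R)).
Hypotheses (mS : measurable S) (S_gt0 : (0 < m S)%E) (S_lty : (m S < +oo)%E).

(** The distribution function of m conditioned on S. *)
Definition cdf_on (z : R) : R := fine (m (S `&` `]-oo, z])) / fine (m S).

Let mSz z : measurable (S `&` `]-oo, z]). Proof. exact: measurableI. Qed.

Let mass_gt0 : 0 < fine (m S).
Proof. by rewrite fine_gt0// S_gt0. Qed.

Let Sz_fin z : m (S `&` `]-oo, z]) \is a fin_num.
Proof.
rewrite ge0_fin_numE//; apply: le_lt_trans S_lty.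
by apply: le_measure; rewrite ?inE//; exact: subIsetl.
Qed.

Lemma cdf_on_ge0 z : 0 <= cdf_on z.
Proof. by rewrite divr_ge0// fine_ge0. Qed.

Lemma cdf_on_le1 z : cdf_on z <= 1.
Proof.
rewrite ler_pdivrMr// mul1r fine_le//; first by rewrite ge0_fin_numE.
by apply: le_measure; rewrite ?inE//; exact: subIsetl.
Qed.

Lemma measurable_cdf_on (D : set R) : measurable D -> measurable_fun D cdf_on.
Proof.
move=> mD; apply: nondecreasing_measurable => // s t st.
rewrite ler_wpM2r ?invr_ge0 ?(ltW mass_gt0)// fine_le//.
apply: le_measure; rewrite ?inE//; apply: setIS => z /=.
by rewrite !in_itv/= => /le_trans; apply.
Qed.

Lemma cdf_on1 z : S `<=` `]-oo, z] -> cdf_on z = 1.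
Proof. by move=> Sz; rewrite /cdf_on setIidl// divff// gt_eqF. Qed.

Lemma cdf_on0 z : S `&` `]-oo, z] = set0 -> cdf_on z = 0.
Proof. by move=> Sz; rewrite /cdf_on Sz measure0 mul0r. Qed.

Lemma cdf_onC z : cdf_on z = 1 - fine (m (S `&` `]z, +oo[)) / fine (m S).
Proof.
have mSz' : measurable (S `&` `]z, +oo[) by exact: measurableI.
have -> : S `&` `]z, +oo[ = S `\` (S `&` `]-oo, z]).
  rewrite setDIr setDv set0U setDE; congr (_ `&` _).
  by rewrite setCitvl.
rewrite measureD// setIA setIid fineB ?Sz_fin ?ge0_fin_numE//.
by rewrite mulrBl divff ?gt_eqF// opprB addrC subrK.
Qed.
End cdf.

Section trapezoid.
Context {R : realType} (m : {measure set (measurableTypeR R) -> \bar R}).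
Hypothesis m_set1 : forall z, m [set z] = 0%E.
Context (u v : \bar R) (x y : R).
Hypothesis xy : x < y.
Local Notation S1 := (oo u x%:E).
Local Notation S2 := (oo y%:E v).
Hypotheses (S1_gt0 : (0 < m S1)%E) (S1_lty : (m S1 < +oo)%E).
Hypotheses (S2_gt0 : (0 < m S2)%E) (S2_lty : (m S2 < +oo)%E).

(** In the scale given by m, this rises from 0 to 1 on (u, x), is 1 on [x, y] and
    falls back to 0 on (y, v). *)
Definition trapezoid (z : R) : R := cdf_on m S1 z - cdf_on m S2 z.

Let mS1 := @measurable_oo R u x%:E.
Let mS2 := @measurable_oo R y%:E v.

Let cdf1 z : x <= z -> cdf_on m S1 z = 1.
Proof.
move=> xz; apply: cdf_on1 => // t [_]; rewrite lte_fin/= in_itv/= => tx.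
by rewrite (le_trans (ltW tx)).
Qed.

Let cdf2 z : z <= y -> cdf_on m S2 z = 0.
Proof.
move=> zy; apply: cdf_on0; apply/seteqP; split => // t [[+ _]].
rewrite lte_fin/= in_itv/= => yt tz.
by have := lt_le_trans yt (le_trans tz zy); rewrite ltxx.
Qed.

Lemma trapezoid_ge0 z : 0 <= trapezoid z.
Proof.
rewrite subr_ge0; have [xz|zx] := leP x z.
  by rewrite cdf1// cdf_on_le1.
by rewrite cdf2 ?cdf_on_ge0// (le_trans (ltW zx))// ltW.
Qed.

Lemma trapezoid_le1 z : trapezoid z <= 1.
Proof. by rewrite lerBlDr ler_wpDr ?cdf_on_ge0 ?cdf_on_le1. Qed.

Lemma measurable_trapezoid (D : set R) : measurable D ->
  measurable_fun D trapezoid.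
Proof. by move=> mD; apply: measurable_funB; exact: measurable_cdf_on. Qed.

Lemma trapezoid_mid z : x <= z -> z <= y -> trapezoid z = 1.
Proof. by move=> xz zy; rewrite /trapezoid cdf1// cdf2// subr0. Qed.

Lemma trapezoid_left z : S1 z ->
  trapezoid z = 1 - fine (m (oo z%:E x%:E)) / fine (m S1).
Proof.
move=> [uz zx]; rewrite /trapezoid cdf2 ?subr0; last first.
  by rewrite lte_fin in zx; rewrite (le_trans (ltW zx))// ltW.
rewrite cdf_onC//; congr (1 - fine (m _) / _).
apply/seteqP; split=> t /=; rewrite in_itv/= andbT.
  by move=> [[_ tx] zt]; split.
by move=> [zt tx]; split => //; split => //; exact: lt_trans zt.
Qed.

Lemma trapezoid_right z : S2 z ->
  trapezoid z = 1 - fine (m (oo y%:E z%:E)) / fine (m S2).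
Proof.
move=> [yz zv]; rewrite /trapezoid cdf1; last first.
  by rewrite lte_fin in yz; rewrite ltW// (lt_trans xy).
congr (1 - _); rewrite /cdf_on; congr (fine _ / _).
have -> : S2 `&` `]-oo, z] = oo y%:E z%:E `|` [set z].
  apply/seteqP; split=> t /=; rewrite in_itv/=.
    move=> [[yt tv]]; rewrite le_eqVlt => /predU1P[->|tz]; [by right|left].
    by split.
  move=> [[yt tz]|->]; last by split.
  split; last by rewrite ltW.
  by split => //; exact: lt_trans zv.
rewrite measureU0//; exact: measurable_oo.
Qed.

Lemma trapezoid_out z : ((z%:E <= u) || (v <= z%:E))%E -> trapezoid z = 0.
Proof.
move=> /orP[zu|vz].
  have [xz|zx] := leP x z.
    have S10 : S1 = set0.
      apply/seteqP; split => // t [ut tx]; have := lt_trans ut tx.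
      by rewrite ltNge (le_trans _ zu)// lee_fin.
    by have := S1_gt0; rewrite S10 measure0 ltxx.
  rewrite /trapezoid cdf2 ?subr0; last by rewrite (le_trans (ltW zx))// ltW.
  apply: cdf_on0; apply/seteqP; split => // t [[ut _]]; rewrite /= in_itv/=.
  rewrite -lee_fin => tz; have := lt_le_trans ut (le_trans tz zu).
  by rewrite ltxx.
have yz : y <= z.
  rewrite leNgt; apply/negP => zy.
  have S20 : S2 = set0.
    apply/seteqP; split => // t [yt tv]; have := lt_le_trans (lt_trans yt tv) vz.
    by rewrite lte_fin ltNge ltW.
  by have := S2_gt0; rewrite S20 measure0 ltxx.
rewrite /trapezoid cdf1 ?(le_trans (ltW xy))// cdf_on1 ?subrr// => t [_ tv].
by rewrite /= in_itv/= -lee_fin ltW// (lt_le_trans tv).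
Qed.

(** On the disjoint intervals (x, y), (s, x) and (y, t) the trapezoid has the
    explicit values found above. *)
Lemma trapezoid_sq_integral_ge (p : {measure set (measurableTypeR R) -> \bar R})
    (s t : R) : s < x -> y < t -> (u <= s%:E)%E -> (t%:E <= v)%E ->
  (p (oo x%:E y%:E)
   + \int[p]_(z in oo s%:E x%:E)
       (((1 - fine (m (oo z%:E x%:E)) / fine (m S1)) ^+ 2)%R)%:E
   + \int[p]_(z in oo y%:E t%:E)
       (((1 - fine (m (oo y%:E z%:E)) / fine (m S2)) ^+ 2)%R)%:E
   <= \int[p]_(z in oo s%:E t%:E) ((trapezoid z ^+ 2)%R)%:E)%E.
Proof.
move=> sx yt us tv.
have mT2 (D : set (measurableTypeR R)) : measurable D ->
    measurable_fun D (fun z => ((trapezoid z ^+ 2)%R)%:E).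
  move=> mD; apply/measurable_EFinP; apply: measurable_funX.
  exact: measurable_trapezoid.
have -> : p (oo x%:E y%:E) =
    (\int[p]_(z in oo x%:E y%:E) ((trapezoid z ^+ 2)%R)%:E)%E.
  transitivity (\int[p]_(z in oo x%:E y%:E) cst 1%E z)%E.
    by rewrite integral_cst ?mul1e//; exact: measurable_oo.
  apply: eq_integral => z; rewrite inE => -[xz zy].
  by rewrite trapezoid_mid ?expr1n ?ltW// -lte_fin.
rewrite [X in (_ + X + _)%E](_ : _ =
    (\int[p]_(z in oo s%:E x%:E) ((trapezoid z ^+ 2)%R)%:E)%E); last first.
  apply: eq_integral => z; rewrite inE => -[sz zx].
  by rewrite trapezoid_left//; split => //; exact: le_lt_trans sz.
rewrite [X in (_ + X)%E](_ : _ =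
    (\int[p]_(z in oo y%:E t%:E) ((trapezoid z ^+ 2)%R)%:E)%E); last first.
  apply: eq_integral => z; rewrite inE => -[yz zt].
  by rewrite trapezoid_right//; split => //; exact: lt_le_trans tv.
have m1 := @measurable_oo R x%:E y%:E.
have m2 := @measurable_oo R s%:E x%:E.
have m3 := @measurable_oo R y%:E t%:E.
rewrite -ge0_integral_setU//; last 3 first.
- by apply: mT2; exact: measurableU.
- by move=> z _; rewrite lee_fin sqr_ge0.
- apply/disj_setPS => z [[+ _] [_ +]] /=; rewrite !lte_fin => xz zx.
  by have := lt_trans xz zx; rewrite ltxx.
rewrite -ge0_integral_setU//; last 4 first.
- exact: measurableU.
- by apply: mT2; do 2 apply: measurableU => //.
- by move=> z _; rewrite lee_fin sqr_ge0.
- apply/disj_setPS => z [[[_ +]|[_ +]] [+ _]] /=; rewrite !lte_fin => zy yz.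
    by have := lt_trans yz zy; rewrite ltxx.
  by have := lt_trans (lt_trans zy xy) yz; rewrite ltxx.
apply: ge0_subset_integral => //.
- by do 2 apply: measurableU => //.
- exact: measurable_oo.
- by apply: mT2; exact: measurable_oo.
- by move=> z _; rewrite lee_fin sqr_ge0.
move=> z [[|]|] [] /=; rewrite !lte_fin => h1 h2; split; rewrite lte_fin.
- exact: lt_trans sx h1.
- exact: lt_trans h2 yt.
- exact: h1.
- exact: lt_trans h2 (lt_trans xy yt).
- exact: lt_trans (lt_trans sx xy) h1.
- exact: h2.
Qed.
End trapezoid.

(** * Test functions and their energy *)

Lemma Lnorm2_eq1 {R : realType} (mu : {measure set (measurableTypeR R) -> \bar R})
    (f : R -> R) : (\int[mu]_z ((f z ^+ 2)%R)%:E = 1)%E ->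
  'N[mu]_2%:E[EFin \o f]%E = 1%E.
Proof.
move=> f1; rewrite unlock (_ : (\int[mu]_x _)%E = 1%E) ?poweR1r//.
rewrite -f1; apply: eq_integral => z _ /=.
by rewrite powR_mulrn// real_normK// num_real.
Qed.

Section test_function.
Context {R : realType} (M N : \bar R) (a b : R -> R) (x0 : R).
Local Notation D := (oo (- M)%E N).
Local Notation w := (scale_density a b x0).
Local Notation lambda := (@lebesgue_measure R).
Hypotheses (Dx0 : D x0) (lif : locally_integrable D (fun u => b u / a u)).
Context (s t : R) (Ds : D s) (Dt : D t).

(** When the derivative is a multiple k of the scale density, the energy is the
    integral of k ^ 2 against the scale measure. The cutoff keeps the derivative
    bounded, hence the primitive Lipschitz. *)
Definition slope (k : R -> R) : R -> R := (fun z => w z * k z) \_ `[s, t].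

Context (k : R -> R) (B : R).
Hypotheses (mk : measurable_fun [set: R] k) (kB : forall z, `|k z| <= B).

Let stD : `[s, t] `<=` D. Proof. exact: subset_itv_oo. Qed.

Lemma measurable_slope : measurable_fun [set: R] (slope k).
Proof.
apply/(measurable_restrictT _ _).1 => //; apply: measurable_funM.
  by apply: measurable_funS (measurable_scale_density Dx0 lif) => //;
    exact: measurable_oo.
exact: measurable_funTS.
Qed.

Lemma slope_bounded : exists K : R, forall z, `|slope k z| <= K.
Proof.
have [K wK] := scale_density_bounded Dx0 lif Ds Dt.
have B0 : 0 <= B by exact: le_trans (kB 0).
exists (`|K| * B) => z; rewrite /slope patchE; case: ifPn => [|_]; last first.
  by rewrite normr0 mulr_ge0.
rewrite inE/= in_itv/= => zst; rewrite normrM ler_pM//.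
rewrite gtr0_norm ?scale_density_gt0// (le_trans (wK _ zst))//; exact: ler_norm.
Qed.

Lemma slope_supp z : ~ `[s, t]%classic z -> slope k z = 0.
Proof. by move=> zst; rewrite /slope patchE memNset. Qed.

Lemma energy_slope_le (r c : R) :
  (energy M N a b x0 (fun z => r * (primitive (slope k) z + c))%R <=
   (r ^+ 2)%:E * \int[lambda]_(z in `[s, t]) ((k z ^+ 2 * w z)%R)%:E)%E.
Proof.
have [K qK] := slope_bounded.
apply: le_trans (energy_primitive_le measurable_slope qK slope_supp r c Dx0 lif) _.
rewrite -ge0_integralZl//; last 3 first.
- apply/measurable_EFinP; apply: measurable_funM.
    by apply: measurable_funX; exact: measurable_funTS.
  by apply: measurable_funS (measurable_scale_density Dx0 lif) => //;
    exact: measurable_oo.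
- by move=> z _; rewrite lee_fin mulr_ge0 ?sqr_ge0// ltW// scale_density_gt0.
- by rewrite lee_fin sqr_ge0.
rewrite -[X in (_ <= \int[lambda]_(z in X) _)%E](setIidr stD)
  [leRHS]integral_mkcondr.
rewrite le_eqVlt; apply/orP; left; apply/eqP; apply: eq_integral => z _.
rewrite /slope !patchE; case: ifPn => [_|_]; last by rewrite mulr0 expr0n mul0r.
rewrite -EFinM; congr EFin; field.
by rewrite gt_eqF// scale_density_gt0.
Qed.
End test_function.

(** * The Dirichlet eigenvalue *)

Section DD.
Context {R : realType} (M N : \bar R) (a b : R -> R) (x0 : R).
Context (mu nu : {measure set (measurableTypeR R) -> \bar R}).
Local Notation D := (oo (- M)%E N).
Local Notation w := (scale_density a b x0).
Local Notation lambda := (@lebesgue_measure R).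
Hypotheses (Dx0 : D x0) (lif : locally_integrable D (fun u => b u / a u)).
Hypotheses (nu_scale : scale_measure M N a b x0 nu).
Hypotheses (mu_fin : locally_finite_on D mu).

Hypotheses (nu_fin : locally_finite_on D nu).

Context (s x y t : R) (Ds : D s) (Dt : D t).
Hypotheses (sx : s < x) (xy : x < y) (yt : y < t).

Local Notation S1 := (oo s%:E x%:E).
Local Notation S2 := (oo y%:E t%:E).
Local Notation n1 := (fine (nu S1)).
Local Notation n2 := (fine (nu S2)).

Let k z := \1_S1 z / n1 - \1_S2 z / n2.
Let mS1 := @measurable_oo R s%:E x%:E.
Let mS2 := @measurable_oo R y%:E t%:E.

Let S1st : S1 `<=` `[s, t].
Proof.
move=> z [] /=; rewrite !lte_fin in_itv/= => sz zx; rewrite ltW//=.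
by rewrite ltW// (lt_trans zx)// (lt_trans xy).
Qed.

Let S2st : S2 `<=` `[s, t].
Proof.
move=> z [] /=; rewrite !lte_fin in_itv/= => yz zt; rewrite (ltW zt) andbT.
by rewrite ltW// (lt_trans sx)// (lt_trans xy).
Qed.

Let stD : `[s, t] `<=` D. Proof. exact: subset_itv_oo. Qed.

Let itv_lty (m : {measure set (measurableTypeR R) -> \bar R})
    (S : set (measurableTypeR R)) : locally_finite_on D m -> measurable S ->
  S `<=` `[s, t] -> (m S < +oo)%E.
Proof.
move=> m_fin mS Sst; apply: le_lt_trans (m_fin `[s, t]%classic _ stD).
  by apply: le_measure; rewrite ?inE.
exact: segment_compact.
Qed.

Let S1_lty : (nu S1 < +oo)%E. Proof. exact: itv_lty. Qed.
Let S2_lty : (nu S2 < +oo)%E. Proof. exact: itv_lty. Qed.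

Let nu_gt0 (u v : R) : s <= u -> u < v -> v <= t -> (0 < nu (oo u%:E v%:E))%E.
Proof.
move=> su uv vt.
apply: (density_gt0 (measurable_oo _ _) (measurable_scale_density Dx0 lif) _ nu_scale
  (measurable_oo _ _) uv) => [z _|z]; first exact: scale_density_gt0.
rewrite /= in_itv/= => /andP[uz zv]; split; first by split; rewrite lte_fin.
apply: stD; rewrite /= in_itv/=.
by rewrite (le_trans su (ltW uz)) (le_trans (ltW zv) vt).
Qed.

Let S1_gt0 : (0 < nu S1)%E.
Proof. by apply: nu_gt0 => //; rewrite ltW// (lt_trans xy). Qed.

Let S2_gt0 : (0 < nu S2)%E.
Proof. by apply: nu_gt0 => //; rewrite ltW// (lt_trans sx). Qed.

Let n1_gt0 : 0 < n1. Proof. by rewrite fine_gt0// S1_gt0. Qed.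
Let n2_gt0 : 0 < n2. Proof. by rewrite fine_gt0// S2_gt0. Qed.

Let mk : measurable_fun [set: R] k.
Proof.
apply: measurable_funB; apply: measurable_funM => //;
  exact: measurable_indic.
Qed.

Let k_bounded z : `|k z| <= n1^-1 + n2^-1.
Proof.
have ind (S : set R) : `|\1_S z : R| <= 1.
  by rewrite indicE; case: (_ \in _); rewrite ?normr1// normr0.
have n1V : 0 < n1^-1 by rewrite invr_gt0.
have n2V : 0 < n2^-1 by rewrite invr_gt0.
apply: (le_trans (ler_normB _ _)).
rewrite !normrM (gtr0_norm n1V) (gtr0_norm n2V).
by rewrite lerD// ler_piMl// ltW.
Qed.

Let int_scale_patch (S A : set (measurableTypeR R)) : measurable S -> measurable A ->
  S `<=` D -> (\int[lambda]_(z in A) ((w \_ S) z)%:E = nu (S `&` A))%E.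
Proof.
move=> mS mA SD; rewrite nu_scale; last exact: measurableI.
rewrite (_ : S `&` A `&` D = A `&` S); last first.
  by rewrite setIAC (setIidl SD) setIC.
rewrite integral_mkcondr; apply: eq_integral => z _.
by rewrite !patchE; case: ifPn.
Qed.

Let slopeE z : slope a b x0 s t k z = (w \_ S1) z / n1 - (w \_ S2) z / n2.
Proof.
rewrite /slope !patchE [point](_ : _ = 0 :> R)// /k !indicE.
case: (boolP (z \in S1)) => [/set_mem/S1st z1|z1];
  case: (boolP (z \in S2)) => [/set_mem/S2st z2|z2].
- by rewrite mem_set// !mulr1n; ring.
- by rewrite mem_set// mulr1n mulr0n; ring.
- by rewrite mem_set// mulr1n mulr0n; ring.
- by case: ifPn => _; rewrite ?mulr0n; ring.
Qed.

Let int_patch (S A : set (measurableTypeR R)) : measurable S -> measurable A ->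
  S `<=` `[s, t] -> lambda.-integrable A (EFin \o (w \_ S)).
Proof.
move=> mS mA Sst; apply/integrableP; split.
  apply/measurable_EFinP; apply: measurable_funTS.
  apply/(measurable_restrictT _ _).1 => //.
  apply: measurable_funS (measurable_scale_density Dx0 lif); first exact: measurable_oo.
  exact: (subset_trans Sst).
rewrite (_ : (\int[_]_(_ in _) _)%E = nu (S `&` A)).
  apply: itv_lty => //; first exact: measurableI.
  by move=> z [/Sst].
rewrite -int_scale_patch//; last exact: subset_trans stD.
apply: eq_integral => z _; rewrite /= ger0_norm// patchE.
by case: ifPn => // _; rewrite ltW// scale_density_gt0.
Qed.

(** Integrating w over a part of S1 or S2 gives back nu, so the primitive is
    assembled from the distribution functions of nu on S1 and S2. *)
Let primitiveE z :
  primitive (slope a b x0 s t k) z = trapezoid nu s%:E t%:E x y z.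
Proof.
rewrite /primitive (_ : slope a b x0 s t k =
  (fun z => (w \_ S1) z / n1 - (w \_ S2) z / n2)); last first.
  by apply/funext => u; rewrite slopeE.
have mA : measurable (`]-oo, z]%classic : set (measurableTypeR R)) by [].
have i1 := int_patch mS1 mA S1st; have i2 := int_patch mS2 mA S2st.
rewrite RintegralB//; last 2 first.
- exact: (integrableZr _ n1^-1 i1).
- exact: (integrableZr _ n2^-1 i2).
rewrite !RintegralZr//; congr (_ / _ - _ / _); rewrite /Rintegral.
  by rewrite int_scale_patch//; exact: subset_trans stD.
by rewrite int_scale_patch//; exact: subset_trans stD.
Qed.

(* k ^ 2 has no cross term because S1 and S2 are disjoint *)
Let slope_energy : (\int[lambda]_(z in `[s, t]) ((k z ^+ 2 * w z)%R)%:E =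
  (n1^-1 + n2^-1)%:E)%E.
Proof.
transitivity (\int[lambda]_(z in `[s, t])
    ((n1 ^- 2)%:E * ((w \_ S1) z)%:E + (n2 ^- 2)%:E * ((w \_ S2) z)%:E))%E.
  apply: eq_integral.
  move=> z _; rewrite -!EFinM -EFinD; congr EFin; rewrite /k !indicE !patchE
    [point](_ : _ = 0 :> R)//.
  case: (boolP (z \in S1)) => [/set_mem[_ z1]|z1];
    case: (boolP (z \in S2)) => [/set_mem[z2 _]|z2].
  - by have := lt_trans z2 z1; rewrite lte_fin ltNge (ltW xy).
  - by rewrite mulr1n mulr0n -!exprVn; ring.
  - by rewrite mulr1n mulr0n -!exprVn; ring.
  - by rewrite !mulr0n; ring.
have w_ge0 (S : set R) z : (0 <= ((w \_ S) z)%:E)%E.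
  by rewrite lee_fin patchE; case: ifPn => // _; rewrite ltW// scale_density_gt0.
have mst : measurable (`[s, t]%classic : set (measurableTypeR R)) by [].
have mw (S : set (measurableTypeR R)) : measurable S -> S `<=` `[s, t] ->
    measurable_fun `[s, t] (fun z => ((w \_ S) z)%:E).
  by move=> mS Sst; have /integrableP[] := int_patch mS mst Sst.
rewrite ge0_integralD//; last 4 first.
- by move=> z _; rewrite mule_ge0// lee_fin.
- by apply: measurable_funeM; exact: mw.
- by move=> z _; rewrite mule_ge0// lee_fin.
- by apply: measurable_funeM; exact: mw.
rewrite !ge0_integralZl//; last 2 first.
- exact: mw.
- exact: mw.
rewrite !int_scale_patch//; last 2 first.
- exact: subset_trans stD.
- exact: subset_trans stD.
rewrite !setIidl// -(@fineK _ (nu S1)) ?ge0_fin_numE//.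
rewrite -(@fineK _ (nu S2)) ?ge0_fin_numE//.
rewrite -!EFinM -EFinD; congr EFin => /=.
by field; rewrite !gt_eqF.
Qed.

(** The trial function is the trapezoid of nu divided by its norm. *)
Lemma lambdaDD_le (V : R) : 0 < V ->
  (V%:E <= mu (oo x%:E y%:E)
   + \int[mu]_(z in S1) (((1 - fine (nu (oo z%:E x%:E)) / n1) ^+ 2)%R)%:E
   + \int[mu]_(z in S2) (((1 - fine (nu (oo y%:E z%:E)) / n2) ^+ 2)%R)%:E)%E ->
  (lambdaDD M N a b x0 mu <= ((n1^-1 + n2^-1) / V)%:E)%E.
Proof.
move=> V0 leV; pose T := trapezoid nu s%:E t%:E x y.
have T0 z : 0 <= T z by exact: trapezoid_ge0.
have T1 z : T z <= 1 by exact: trapezoid_le1.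
have mT (A : set (measurableTypeR R)) : measurable A ->
    measurable_fun A (fun z => ((T z ^+ 2)%R)%:E).
  move=> mA; apply/measurable_EFinP; apply: measurable_funX.
  exact: measurable_trapezoid.
have T20 z : (0 <= ((T z ^+ 2)%R)%:E)%E by rewrite lee_fin sqr_ge0.
have Tout z : ~ `[s, t]%classic z -> T z = 0.
  move=> zst; apply: trapezoid_out => //; rewrite !lee_fin.
  apply/negPn/negP; rewrite negb_or -!ltNge => /andP[sz zt].
  by apply: zst; rewrite /= in_itv/= !ltW.
pose I := (\int[mu]_z ((T z ^+ 2)%R)%:E)%E.
have I_lty : (I < +oo)%E.
  have -> : I = (\int[mu]_(z in `[s, t]) ((T z ^+ 2)%R)%:E)%E.
    rewrite [RHS]integral_mkcond; apply: eq_integral => z _.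
    rewrite patchE; case: ifPn => //; rewrite notin_setE => /Tout ->.
    by rewrite expr0n.
  apply: (@le_lt_trans _ _ (mu `[s, t]%classic)); last exact: itv_lty.
  have mst : measurable (`[s, t]%classic : set (measurableTypeR R)) by [].
  rewrite -[leRHS]mul1e -(integral_cst mu mst).
  apply: ge0_le_integral => //; first exact: mT.
  by move=> z _; rewrite lee_fin expr_le1.
have VI : (V%:E <= I)%E.
  apply: (le_trans leV); apply: (@le_trans _ _
    (\int[mu]_(z in oo s%:E t%:E) ((T z ^+ 2)%R)%:E)%E).
    apply: trapezoid_sq_integral_ge => //.
    exact: density_set1 nu_scale.
  apply: ge0_subset_integral => //; [exact: measurable_oo|exact: mT].
pose W := fine I.
have IW : I = W%:E by rewrite fineK// ge0_fin_numE// integral_ge0.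
have VW : V <= W by rewrite -lee_fin -IW.
have W0 : 0 < W by exact: lt_le_trans V0 VW.
pose r := (Num.sqrt W)^-1.
have r2 : r ^+ 2 = W^-1 by rewrite exprVn sqr_sqrtr// ltW.
pose f z := r * (primitive (slope a b x0 s t k) z + 0).
have fE z : f z = r * T z by rewrite /f addr0 primitiveE.
apply: (@le_trans _ _ (energy M N a b x0 f)).
  apply: ereal_inf_lbound; exists f => //; split.
    split.
      have [K qK] := slope_bounded Dx0 lif Ds Dt k_bounded.
      apply: (primitive_AC _ qK (@slope_supp _ a b x0 s t k)).
      exact: (measurable_slope Dx0 lif Ds Dt mk).
    exists `[s, t]%classic; split => //; first exact: segment_compact.
    by move=> z _ /Tout Tz; rewrite fE Tz mulr0.
  apply: Lnorm2_eq1.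
  transitivity (\int[mu]_z ((r ^+ 2)%:E * ((T z ^+ 2)%R)%:E))%E.
    by apply: eq_integral => z _; rewrite fE exprMn EFinM.
  rewrite ge0_integralZl//; last 2 first.
  - exact: mT.
  - by rewrite lee_fin sqr_ge0.
  by rewrite -/I IW -EFinM r2 mulVf// gt_eqF.
apply: le_trans (energy_slope_le Dx0 lif Ds Dt mk k_bounded r 0) _.
rewrite slope_energy -EFinM lee_fin r2 mulrC.
have A0 : 0 <= n1^-1 + n2^-1 by rewrite addr_ge0// invr_ge0 ltW.
by apply: ler_wpM2l => //; rewrite lef_pV2.
Qed.
End DD.

(** * The Neumann eigenvalue *)

Section finite_mass.
Context {R : realType} (m : {measure set (measurableTypeR R) -> \bar R}).
Hypothesis m_lty : (m setT < +oo)%E.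
Local Notation lambda := (@lebesgue_measure R).

(** Both sides integrate q(u) over the pairs (z, u) with z in S and u <= z. *)
Lemma tonelli_primitive (S : set (measurableTypeR R)) (q : R -> R) :
  measurable S -> measurable_fun [set: R] q -> (forall u, 0 <= q u) ->
  (\int[m]_(z in S) \int[lambda]_(u in `]-oo, z]) (q u)%:E =
   \int[lambda]_u ((q u)%:E * m (S `&` `[u, +oo[)))%E.
Proof.
move=> mS mq q0.
(* the restriction of m to the whole line carries the sigma-finite structure *)
pose m' : {finite_measure set (measurableTypeR R) -> \bar R} :=
  mfrestr measurableT m_lty.
have m'E (g : R -> \bar R) : (\int[m']_z g z = \int[m]_z g z)%E.
  by apply: eq_measure_integral => C mC _; rewrite /= /mfrestr /mrestr setIT.
pose A := [set p : measurableTypeR R * measurableTypeR R | p.2 <= p.1] `&`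
  (S `*` setT).
pose f (p : measurableTypeR R * measurableTypeR R) :=
  ((q p.2 * \1_A p)%R%:E : \bar R).
have mA : measurable A.
  apply: measurableI; last exact: measurableX.
  have mB : measurable_fun [set: measurableTypeR R * measurableTypeR R]
      (fun p => p.1 - p.2 : R).
    by apply: measurable_funB; [exact: measurable_fst|exact: measurable_snd].
  have := mB measurableT _ (measurable_itv `[0, +oo[).
  rewrite setTI; congr measurable; apply/seteqP; split => p /=;
    by rewrite in_itv/= andbT subr_ge0.
have f0 p : (0 <= f p)%E by rewrite lee_fin mulr_ge0.
have mf : measurable_fun setT f.
  apply/measurable_EFinP; apply: measurable_funM.
    by apply: measurableT_comp.
  exact: measurable_indic.
have := @fubini_tonelli _ _ _ _ R m' lambda f mf f0.
rewrite m'E (_ : (\int[m]_x _)%E =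
    (\int[m]_(z in S) \int[lambda]_(u in `]-oo, z]) (q u)%:E)%E); last first.
  rewrite [RHS]integral_mkcond; apply: eq_integral => z _; rewrite patchE.
  case: ifPn => zS.
    rewrite [RHS]integral_mkcond; apply: eq_integral => u _.
    rewrite patchE /f /= indicE.
    rewrite (_ : (_ \in A) = (u \in `]-oo, z]%classic)); last first.
      apply/idP/idP; rewrite !inE /A /= in_itv/=; first by case.
      by move=> uz; split => //; split => //; exact: set_mem.
    by case: ifPn => _; rewrite ?mulr1n ?mulr0n ?mulr1 ?mulr0.
  apply: integral0_eq => u _; rewrite /f indicE memNset ?mulr0//.
  by move=> [_ [/= Sz _]]; move: zS; rewrite mem_set.
move=> ->; apply: eq_integral => u _; rewrite m'E.
have mSu : measurable (S `&` `[u, +oo[) by exact: measurableI.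
rewrite -(setIT (S `&` _)) -(integral_indic m measurableT mSu).
rewrite -ge0_integralZl//; last 2 first.
- exact/measurable_EFinP/measurable_indic.
- by rewrite lee_fin.
apply: eq_integral => z _; rewrite /f -EFinM /= !indicE; congr (_ * _%:R)%:E.
congr nat_of_bool; apply/idP/idP; rewrite !inE /A /= in_itv/= andbT.
  by move=> [? []].
by move=> [].
Qed.

Context (S : set (measurableTypeR R)) (mS : measurable S).
Hypothesis S_gt0 : (0 < m S)%E.
Context (f : R -> R) (B : R).
Hypotheses (mf : measurable_fun [set: R] f) (fB : forall z, `|f z| <= B).

Lemma bounded_integrable (A : set (measurableTypeR R)) : measurable A ->
  m.-integrable A (EFin \o f).
Proof.
move=> mA; apply: measurable_bounded_integrable => //.
- by apply: le_lt_trans m_lty; apply: le_measure; rewrite ?inE.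
- exact: measurable_funTS.
exists B; split; first exact: num_real.
by move=> x Bx z _ /=; rewrite (le_trans (fB z))// ltW.
Qed.
End finite_mass.

(** The integral over S of the square of f minus its mean over S is nonnegative. *)
Lemma jensen_sq {R : realType} (m : {measure set (measurableTypeR R) -> \bar R})
  (S : set (measurableTypeR R)) (f : R -> R) (B : R) :
  (m setT < +oo)%E -> measurable S -> (0 < m S)%E ->
  measurable_fun [set: R] f -> (forall z, `|f z| <= B) ->
  (((\int[m]_(z in S) f z) ^+ 2 / fine (m S))%:E <=
   \int[m]_(z in S) ((f z ^+ 2)%R)%:E)%E.
Proof.
move=> m_lty mS S_gt0 mf fB.
have S_lty : (m S < +oo)%E.
  by apply: le_lt_trans m_lty; apply: le_measure; rewrite ?inE.
have mass_gt0 : 0 < fine (m S) by rewrite fine_gt0// S_gt0.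
have intf := bounded_integrable m_lty mf fB mS.
have int2 : m.-integrable S (EFin \o (fun z => f z ^+ 2)).
  apply: (@bounded_integrable _ _ m_lty _ (B ^+ 2)) => //.
    exact: measurable_funX.
  by move=> z; rewrite normrX lerXn2r ?nnegrE// (le_trans _ (fB z)).
pose p := (\int[m]_(z in S) f z) / fine (m S).
have intp : m.-integrable S (EFin \o cst (p ^+ 2)).
  by apply: (@bounded_integrable _ _ m_lty _ `|p ^+ 2|) => //.
have intfp : m.-integrable S (EFin \o (fun z => f z * (2 * p))).
  exact: (integrableZr _ (2 * p) intf).
have fE : (\int[m]_(z in S) ((f z ^+ 2)%R)%:E =
    (\int[m]_(z in S) (f z ^+ 2))%:E)%E.
  by rewrite /Rintegral fineK//; exact: integrable_fin_num int2.
rewrite fE lee_fin -subr_ge0.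
have -> : \int[m]_(z in S) (f z ^+ 2) -
    (\int[m]_(z in S) f z) ^+ 2 / fine (m S) =
    \int[m]_(z in S) (f z ^+ 2 - f z * (2 * p) + cst (p ^+ 2) z).
  rewrite RintegralD//; last exact: (integrableB _ int2 intfp).
  rewrite RintegralB// RintegralZr// Rintegral_cst// /p.
  by field; rewrite gt_eqF.
apply: Rintegral_ge0 => z _; rewrite /= (_ : _ + _ = (f z - p) ^+ 2); last by ring.
exact: sqr_ge0.
Qed.

Section conditional_mean.
Context {R : realType} (m : {measure set (measurableTypeR R) -> \bar R}).
Hypotheses (m_lty : (m setT < +oo)%E) (m_set1 : forall z, m [set z] = 0%E).
Local Notation lambda := (@lebesgue_measure R).
Context (q : R -> R) (K s t : R).
Hypotheses (mq : measurable_fun [set: R] q) (q0 : forall u, 0 <= q u).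
Hypotheses (qK : forall z, `|q z| <= K).
Hypotheses (q_supp : forall z, ~ `[s, t]%classic z -> q z = 0).

Lemma integrable_mul_bounded (g : R -> R) :
  measurable_fun [set: R] g -> (forall u, 0 <= g u <= 1) ->
  lambda.-integrable setT (EFin \o (fun u => q u * g u)).
Proof.
move=> mg g01; have iq := primitive_integrable mq qK q_supp measurableT.
apply: le_integrable iq => //.
  by apply/measurable_EFinP; exact: measurable_funM.
move=> u _ /=; rewrite lee_fin normrM ler_piMr//.
by have /andP[g0 g1] := g01 u; rewrite ger0_norm.
Qed.

(** Integration by parts in Tonelli form: the primitive at z collects q(u) over
    u <= z, and 1 - cdf_on m S u is the conditional mass of the z beyond u. *)
Lemma conditional_mean_primitive (S : set (measurableTypeR R)) :
  measurable S -> (0 < m S)%E ->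
  \int[m]_(z in S) primitive q z / fine (m S) =
  \int[lambda]_u (q u * (1 - cdf_on m S u)).
Proof.
move=> mS S_gt0.
have sub_lty (A : set (measurableTypeR R)) : measurable A -> (m A < +oo)%E.
  by move=> mA; apply: le_lt_trans m_lty; apply: le_measure; rewrite ?inE.
have S_lty := sub_lty _ mS.
have mass_gt0 : 0 < fine (m S) by rewrite fine_gt0// S_gt0.
have mg : measurable_fun [set: R] (fun u => 1 - cdf_on m S u).
  by apply: measurable_funB => //; exact: measurable_cdf_on.
have ig := integrable_mul_bounded mg _.
apply: (@mulIf _ (fine (m S))); first by rewrite gt_eqF.
rewrite divfK ?gt_eqF// -RintegralZr//; last first.
  apply: ig => u; rewrite subr_ge0 cdf_on_le1//= lerBlDr lerDl.
  exact: cdf_on_ge0.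
rewrite /Rintegral; congr fine.
transitivity (\int[m]_(z in S) \int[lambda]_(u in `]-oo, z]) (q u)%:E)%E.
  apply: eq_integral => z _; rewrite /primitive /Rintegral fineK//.
  apply: integrable_fin_num => //.
  exact: (primitive_integrable mq qK q_supp).
rewrite tonelli_primitive//; apply: eq_integral => u _.
have mSu : measurable (S `&` `]u, +oo[) by exact: measurableI.
have -> : m (S `&` `[u, +oo[) = m (S `&` `]u, +oo[).
  have [Su|Su] := pselect (S u); last first.
    congr (m _); apply/seteqP; split => z /= [Sz]; rewrite !in_itv/= !andbT.
      by rewrite le_eqVlt => /predU1P[uz|//]; rewrite uz in Su.
    by move/ltW.
  rewrite (_ : S `&` `[u, +oo[ = S `&` `]u, +oo[ `|` [set u]) ?measureU0//.
  apply/seteqP; split => z /=; rewrite !in_itv/= !andbT.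
    move=> [Sz]; rewrite le_eqVlt => /predU1P[uz|uz]; [by right|by left].
  by move=> [[Sz /ltW]|->].
rewrite cdf_onC// subKr -[X in (_ * X)%E]fineK; last first.
  by rewrite ge0_fin_numE// sub_lty.
by rewrite -EFinM; congr EFin; rewrite mulrA divfK// gt_eqF.
Qed.
End conditional_mean.

Section NN.
Context {R : realType} (M N : \bar R) (a b : R -> R) (x0 : R).
Context (mu nu : {measure set (measurableTypeR R) -> \bar R}).
Local Notation D := (oo (- M)%E N).
Local Notation w := (scale_density a b x0).
Local Notation lambda := (@lebesgue_measure R).
Hypotheses (Dx0 : D x0) (lif : locally_integrable D (fun u => b u / a u)).
Hypotheses (nu_scale : scale_measure M N a b x0 nu).
Hypotheses (mu_lty : (mu setT < +oo)%E) (mu_set1 : forall z, mu [set z] = 0%E).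

Context (s x y t : R) (Ds : D s) (Dt : D t).
Hypotheses (sx : s < x) (xy : x < y) (yt : y < t).

Local Notation S1 := (oo (- M)%E x%:E).
Local Notation S2 := (oo y%:E N).
Local Notation m1 := (fine (mu S1)).
Local Notation m2 := (fine (mu S2)).
Hypotheses (S1_gt0 : (0 < mu S1)%E) (S2_gt0 : (0 < mu S2)%E).

Let mS1 := @measurable_oo R (- M)%E x%:E.
Let mS2 := @measurable_oo R y%:E N.

Let mu_fin (A : set (measurableTypeR R)) : measurable A -> (mu A < +oo)%E.
Proof.
by move=> mA; apply: le_lt_trans mu_lty; apply: le_measure; rewrite ?inE.
Qed.

Let m1_gt0 : 0 < m1. Proof. by rewrite fine_gt0// S1_gt0 mu_fin. Qed.
Let m2_gt0 : 0 < m2. Proof. by rewrite fine_gt0// S2_gt0 mu_fin. Qed.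

Let k := trapezoid mu (- M)%E N x y.
Let k_ge0 z : 0 <= k z. Proof. by apply: trapezoid_ge0 => //; exact: mu_fin. Qed.
Let k_le1 z : k z <= 1. Proof. by apply: trapezoid_le1 => //; exact: mu_fin. Qed.
Let mk : measurable_fun [set: R] k.
Proof. by apply: measurable_trapezoid => //; exact: mu_fin. Qed.
Let k_norm z : `|k z| <= 1. Proof. by rewrite ger0_norm. Qed.

Let q := slope a b x0 s t k.
Let mq : measurable_fun [set: R] q.
Proof. exact: (measurable_slope Dx0 lif Ds Dt mk). Qed.
Let q_supp z : ~ `[s, t]%classic z -> q z = 0. Proof. exact: slope_supp. Qed.
Let q_ge0 z : 0 <= q z.
Proof.
rewrite /q /slope patchE; case: ifPn => // _.
by rewrite mulr_ge0// ltW// scale_density_gt0.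
Qed.

Let P := primitive q.
Let E := \int[lambda]_u (q u * k u).

Let energyE : (\int[lambda]_(z in `[s, t]) ((k z ^+ 2 * w z)%R)%:E = E%:E)%E.
Proof.
have [K qK] := slope_bounded Dx0 lif Ds Dt k_norm.
rewrite /E /Rintegral fineK; last first.
  apply: integrable_fin_num => //.
  apply: (integrable_mul_bounded mq qK q_supp mk) => u.
  by rewrite k_ge0 k_le1.
rewrite [LHS]integral_mkcond; apply: eq_integral => z _.
rewrite /q /slope !patchE; case: ifPn => _; last by rewrite mul0r.
by congr EFin; ring.
Qed.

(** The derivative of the trapezoid with respect to mu is the difference of the
    two conditional laws, so the difference of the conditional means of P is, by
    parts, the integral of the trapezoid against the derivative of P. *)
Let mean_gap : \int[mu]_(z in S2) P z / m2 - \int[mu]_(z in S1) P z / m1 = E.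
Proof.
have [K qK] := slope_bounded Dx0 lif Ds Dt k_norm.
rewrite !(conditional_mean_primitive mu_lty mu_set1 mq q_ge0 qK q_supp)//.
have bnd (S : set (measurableTypeR R)) : measurable S -> (0 < mu S)%E ->
    lambda.-integrable setT (EFin \o (fun u => q u * (1 - cdf_on mu S u))).
  move=> mS S0; apply: (integrable_mul_bounded mq qK q_supp).
    apply: measurable_funB => //; apply: measurable_cdf_on => //.
    exact: mu_fin.
  move=> u; rewrite subr_ge0 lerBlDr lerDl cdf_on_le1 ?cdf_on_ge0//.
  exact: mu_fin.
rewrite -RintegralB//; [|exact: bnd|exact: bnd].
by apply: eq_Rintegral => u _; rewrite /k /trapezoid; ring.
Qed.

(** A function whose means on S1 and S2 differ by E has large second moment on
    these two sets, whatever constant is added to it. *)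
Let variance_ge (c : R) : ((E ^+ 2 / (m1^-1 + m2^-1))%:E <=
  \int[mu]_z (((P z + c) ^+ 2)%R)%:E)%E.
Proof.
have [K qK] := slope_bounded Dx0 lif Ds Dt k_norm.
have [B PB] := primitive_bounded mq qK q_supp.
have mP : measurable_fun [set: R] P := measurable_primitive mq qK q_supp.
have mPc : measurable_fun [set: R] (fun z => P z + c) by exact: measurable_funD.
have PcB z : `|P z + c| <= B + `|c|.
  by rewrite (le_trans (ler_normD _ _))// lerD2r.
have mPc2 (A : set (measurableTypeR R)) :
    measurable_fun A (fun z => (((P z + c) ^+ 2)%R)%:E).
  by apply/measurable_EFinP; apply: measurable_funTS; exact: measurable_funX.
apply: (@le_trans _ _
  (\int[mu]_(z in S1 `|` S2) (((P z + c) ^+ 2)%R)%:E)%E); last first.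
  apply: ge0_subset_integral => //; first exact: measurableU.
  by move=> z _; rewrite lee_fin sqr_ge0.
rewrite ge0_integral_setU//; last 2 first.
- by move=> z _; rewrite lee_fin sqr_ge0.
- apply/disj_setPS => z [[_ +] [+ _]] /=; rewrite !lte_fin => zx yz.
  by have := lt_trans (lt_trans zx xy) yz; rewrite ltxx.
apply: le_trans (leeD (jensen_sq mu_lty mS1 S1_gt0 mPc PcB)
  (jensen_sq mu_lty mS2 S2_gt0 mPc PcB)).
rewrite -EFinD lee_fin.
have iP (A : set (measurableTypeR R)) (mA : measurable A) :=
  bounded_integrable mu_lty mP PB mA.
have ic (A : set (measurableTypeR R)) (mA : measurable A) :
    mu.-integrable A (EFin \o cst c).
  by apply: (@bounded_integrable _ _ mu_lty _ `|c|) => //.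
rewrite !RintegralD ?Rintegral_cst ?iP ?ic ?mu_fin//.
rewrite -mean_gap.
set p1 := \int[mu]_(x in S1) P x; set p2 := \int[mu]_(x in S2) P x.
pose e1 := p1 / m1 + c; pose e2 := p2 / m2 + c.
have -> : p2 / m2 - p1 / m1 = e2 - e1 by rewrite /e1 /e2; ring.
have -> : p1 + c * m1 = e1 * m1 by rewrite /e1; field; rewrite gt_eqF.
have -> : p2 + c * m2 = e2 * m2 by rewrite /e2; field; rewrite gt_eqF.
(* the variance of a variable with values e1 and e2 and weights m1 and m2 *)
have -> : (e2 - e1) ^+ 2 / (m1^-1 + m2^-1) =
    (e1 * m1) ^+ 2 / m1 + (e2 * m2) ^+ 2 / m2 -
    (m1 * e1 + m2 * e2) ^+ 2 / (m1 + m2).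
  by field; rewrite !gt_eqF// addr_gt0.
by rewrite gerBl divr_ge0 ?sqr_ge0// ltW// addr_gt0.
Qed.

(** The trial function is the centred primitive of the cut-off trapezoid, divided
    by its norm. Before the division its energy is at most E and its squared norm
    at least E ^ 2 / (1 / m1 + 1 / m2), and E is at least V. *)
Lemma lambdaNN_le (V : R) : 0 < V ->
  (V%:E <= nu (oo x%:E y%:E)
   + \int[nu]_(z in oo s%:E x%:E)
       (((1 - fine (mu (oo z%:E x%:E)) / m1) ^+ 2)%R)%:E
   + \int[nu]_(z in oo y%:E t%:E)
       (((1 - fine (mu (oo y%:E z%:E)) / m2) ^+ 2)%R)%:E)%E ->
  (lambdaNN M N a b x0 mu <= ((m1^-1 + m2^-1) / V)%:E)%E.
Proof.
move=> V0 leV; pose A := m1^-1 + m2^-1.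
have A0 : 0 < A by rewrite addr_gt0// invr_gt0.
have VE : V <= E.
  rewrite -lee_fin -energyE; apply: (le_trans leV).
  apply: (@le_trans _ _ (\int[nu]_(z in oo s%:E t%:E) ((k z ^+ 2)%R)%:E)%E).
    apply: trapezoid_sq_integral_ge => //.
    - exact: mu_fin.
    - exact: mu_fin.
    - by rewrite ltW//; have [] := Ds.
    - by rewrite ltW//; have [] := Dt.
  have stD : `[s, t] `<=` D by exact: subset_itv_oo.
  have mst := @measurable_oo R s%:E t%:E.
  apply: (le_trans (ge0_density_integral_le (measurable_oo _ _)
    (measurable_scale_density Dx0 lif) _ nu_scale mst _ _)).
  - by move=> z _; exact: scale_density_gt0.
  - by apply: measurable_funTS; exact: measurable_funX.
  - by move=> z _; rewrite sqr_ge0.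
  apply: ge0_subset_integral => //.
  - by apply: measurableI => //; exact: measurable_oo.
  - apply/measurable_EFinP; apply: measurable_funM.
      by apply: measurable_funTS; exact: measurable_funX.
    by apply: measurable_funS (measurable_scale_density Dx0 lif) => //;
    exact: measurable_oo.
  - by move=> z _; rewrite lee_fin mulr_ge0 ?sqr_ge0// ltW// scale_density_gt0.
  by move=> z [[sz zt] _]; rewrite /= in_itv/= -!lee_fin !ltW.
have E0 : 0 < E by exact: lt_le_trans V0 VE.
have [K qK] := slope_bounded Dx0 lif Ds Dt k_norm.
have [B PB] := primitive_bounded mq qK q_supp.
have mP : measurable_fun [set: R] P := measurable_primitive mq qK q_supp.
pose c := - (\int[mu]_z P z / fine (mu setT)).
have mPc : measurable_fun [set: R] (fun z => P z + c) by exact: measurable_funD.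
have PcB z : `|P z + c| <= B + `|c|.
  by rewrite (le_trans (ler_normD _ _))// lerD2r.
have mu_gt0 : (0 < mu setT)%E.
  by apply: lt_le_trans S1_gt0 _; apply: le_measure; rewrite ?inE.
have mean0 : \int[mu]_z (P z + c) = 0.
  have iP := bounded_integrable mu_lty mP PB measurableT.
  have ic : mu.-integrable setT (EFin \o cst c).
    by apply: (@bounded_integrable _ _ mu_lty _ `|c|) => //.
  rewrite RintegralD// Rintegral_cst// /c mulNr divfK ?subrr//.
  by rewrite gt_eqF// fine_gt0// mu_gt0.
have ip2 : mu.-integrable setT (EFin \o (fun z => (P z + c) ^+ 2)).
  apply: (@bounded_integrable _ _ mu_lty _ ((B + `|c|) ^+ 2)) => //.
    exact: measurable_funX.
  by move=> z; rewrite normrX lerXn2r ?nnegrE// (le_trans _ (PcB z)).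
pose W := \int[mu]_z ((P z + c) ^+ 2).
have WE : (\int[mu]_z (((P z + c) ^+ 2)%R)%:E = W%:E)%E.
  by rewrite /W /Rintegral fineK//; exact: integrable_fin_num ip2.
have EW : E ^+ 2 / A <= W by rewrite -lee_fin -WE; exact: variance_ge.
have W0 : 0 < W by apply: lt_le_trans EW; rewrite divr_gt0// exprn_gt0.
pose r := (Num.sqrt W)^-1.
have r2 : r ^+ 2 = W^-1 by rewrite exprVn sqr_sqrtr// ltW.
pose f z := r * (P z + c).
apply: (@le_trans _ _ (energy M N a b x0 f)).
  apply: ereal_inf_lbound; exists f => //; split.
  - exact: (primitive_AC mq qK q_supp).
  - have iPc := bounded_integrable mu_lty mPc PcB measurableT.
    transitivity ((\int[mu]_z (f z))%:E).
      rewrite /Rintegral fineK//; apply: integrable_fin_num => //.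
      exact: (integrableZl _ r iPc).
    by rewrite RintegralZl// mean0 mulr0.
  - apply: Lnorm2_eq1.
    transitivity (\int[mu]_z ((r ^+ 2)%:E * (((P z + c) ^+ 2)%R)%:E))%E.
      by apply: eq_integral => z _; rewrite /f exprMn EFinM.
    rewrite ge0_integralZl//; last 3 first.
    + by apply/measurable_EFinP; exact: measurable_funX.
    + by move=> z _; rewrite lee_fin sqr_ge0.
    + by rewrite lee_fin sqr_ge0.
    by rewrite WE -EFinM r2 mulVf// gt_eqF.
apply: le_trans (energy_slope_le Dx0 lif Ds Dt mk k_norm r c) _.
rewrite energyE -EFinM lee_fin r2.
apply: (@le_trans _ _ (A / E)).
  rewrite mulrC ler_pdivrMr// mulrAC ler_pdivlMr//.
  by move: EW; rewrite ler_pdivrMr// mulrC expr2.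
by apply: ler_wpM2l; [exact: ltW|rewrite lef_pV2].

Qed.
End NN.

(** * Exhausting the interval *)

Lemma inve_gt0_EFin {R : realType} (X : \bar R) : (0 < X)%E ->
  (X^-1 = (fine X)^-1%:E)%E.
Proof.
case: X => [r| |]//=; last by rewrite invey invr0.
by rewrite lte_fin => r0; rewrite inver gt_eqF.
Qed.

(** Real quotients avoid the products 0 * +oo and the quotients +oo / +oo that a
    direct passage to the limit would meet when B is infinite. *)
Lemma ratio_le_limit {R : realType} (l B : \bar R) (A : R) : 0 <= A -> (0 < B)%E ->
  (forall e V : R, A < e -> 0 < V -> (V%:E < B)%E -> (l <= (e / V)%:E)%E) ->
  (l <= A%:E * B^-1)%E.
Proof.
move=> A0 B0 H; rewrite inve_gt0_EFin//; set beta := (fine B)^-1.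
have b0 : 0 <= beta by rewrite invr_ge0 fine_ge0// ltW.
apply/lee_addgt0Pr => eps eps0; rewrite -EFinM -EFinD.
(* V below is e / (A * beta + eps), so that e / V is exactly A * beta + eps; the
   excess of e over A is small enough for V * beta < 1 *)
pose e := A + eps / (beta + 1).
have b1 : 0 < beta + 1 by rewrite ltr_wpDl.
have Ae : A < e by rewrite ltrDl divr_gt0.
have e0 : 0 < e by exact: le_lt_trans Ae.
have d0 : 0 < A * beta + eps by rewrite ltr_wpDl// mulr_ge0.
have -> : A * beta + eps = e / (e / (A * beta + eps)).
  by field; rewrite !gt_eqF.
apply: H => //; first by rewrite divr_gt0.
have : e * beta < A * beta + eps.
  rewrite /e mulrDl ltrD2l mulrAC ltr_pdivrMr// mulrDr mulr1.
  by rewrite ltr_pwDr// mulrC.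
move=> ed; have [->|By] := eqVneq B +oo%E; first by rewrite ltry.
have Bfin : B \is a fin_num by rewrite ge0_fin_numE ?ltW// ltey.
have fB0 : 0 < fine B by rewrite fine_gt0// B0 ltey.
rewrite -(fineK Bfin) lte_fin ltr_pdivrMr// mulrC.
by move: ed; rewrite /beta ltr_pdivrMr.
Qed.

Section monotone_side.
Context {R : realType} (p : {measure set (measurableTypeR R) -> \bar R}).
Context (I_ : nat -> set (measurableTypeR R)) (I : set (measurableTypeR R)).
Hypotheses (mI_ : forall n, measurable (I_ n)) (I_nd : nondecreasing_seq I_).
Hypothesis (I_U : I = \bigcup_n I_ n).
Context (r : R -> R) (c : nat -> R) (C : R).
Hypotheses (mr : forall n, measurable_fun (I_ n) r) (r0 : forall z, 0 <= r z).
Hypotheses (c_ni : nonincreasing_seq c) (cC : c n @[n --> \oo] --> C).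
Hypotheses (rc : forall n z, I_ n z -> r z * c n <= 1).

(** On I_ n the function 1 - r c_n is nonnegative, and it increases with n since c
    decreases: monotone convergence applies although both the domain and the
    integrand vary. *)
Lemma cvg_side_integral :
  ((\int[p]_(z in I_ n) (((1 - r z * c n) ^+ 2)%R)%:E)%E @[n --> \oo] -->
    (\int[p]_(z in I) (((1 - r z * C) ^+ 2)%R)%:E)%E).
Proof.
pose g n := (fun z => (((1 - r z * c n) ^+ 2)%R)%:E) \_ (I_ n).
have mI : measurable I by rewrite I_U; exact: bigcup_measurable.
have I_I n : I_ n `<=` I by rewrite I_U; exact: bigcup_sup.
have -> : (fun n => \int[p]_(z in I_ n) (((1 - r z * c n) ^+ 2)%R)%:E)%E =
    (fun n => \int[p]_(z in I) g n z)%E.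
  by apply/funext => n; rewrite -(setIidr (@I_I n)) integral_mkcondr.
have g0 n z : (0 <= g n z)%E.
  by rewrite /g patchE; case: ifPn => // _; rewrite lee_fin sqr_ge0.
have gnd z : nondecreasing_seq (g ^~ z).
  move=> i j ij; rewrite /g !patchE; case: ifPn => zi; last first.
    by case: ifPn => // _; rewrite lee_fin sqr_ge0.
  have Ii : I_ i z by exact: set_mem.
  have Ij : I_ j z by have /subsetPset := I_nd ij; apply.
  rewrite mem_set// lee_fin lerXn2r ?nnegrE ?subr_ge0 ?rc//.
  by rewrite lerD2l lerN2 ler_wpM2l// c_ni.
have mg n : measurable_fun I (g n).
  apply/(measurable_restrict _ _ _).1 => //; rewrite setIidr//.
  apply/measurable_EFinP; apply: measurable_funX; apply: measurable_funB => //.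
  exact: measurable_funM.
have -> : (\int[p]_(z in I) (((1 - r z * C) ^+ 2)%R)%:E =
    \int[p]_(z in I) (limn (g ^~ z)))%E.
  apply: eq_integral => z; rewrite inE I_U => -[k _ Ikz].
  apply/esym/cvg_lim => //.
  have : (((1 - r z * c n) ^+ 2)%:E @[n --> \oo] --> ((1 - r z * C) ^+ 2)%:E)%E.
    apply: cvg_EFin; first exact: nearW.
    have h : (1 - r z * c n) @[n --> \oo] --> 1 - r z * C.
      by apply: cvgB; [exact: cvg_cst|apply: cvgMr].
    exact: (cvgM h h).
  apply: cvg_trans; apply: near_eq_cvg; near=> n.
  rewrite /g patchE mem_set//.
  have /subsetPset : (I_ k <= I_ n)%O by apply: I_nd; near: n; exact: nbhs_infty_ge.
  exact.
by apply: cvg_monotone_convergence => // n z _; exact: g0.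
Unshelve. all: by end_near. Qed.
End monotone_side.

Section exhaustion_oo.
Context {R : realType} (u v : \bar R) (x y : R) (s t : nat -> R).
Hypotheses (s_ni : nonincreasing_seq s) (t_nd : nondecreasing_seq t).
Hypotheses (us : forall n, (u < (s n)%:E)%E /\ s n < x).
Hypotheses (tv : forall n, ((t n)%:E < v)%E /\ y < t n).
Hypotheses (s_ex : forall z : R, (u < z%:E)%E -> exists n, s n < z).
Hypotheses (t_ex : forall z : R, (z%:E < v)%E -> exists n, z < t n).

Lemma nondecreasing_oo_left :
  nondecreasing_seq (fun n => oo (s n)%:E x%:E : set (measurableTypeR R)).
Proof.
move=> i j ij; apply/subsetPset => z [sz zx]; split => //.
by apply: le_lt_trans sz; rewrite lee_fin s_ni.
Qed.

Lemma nondecreasing_oo_right :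
  nondecreasing_seq (fun n => oo y%:E (t n)%:E : set (measurableTypeR R)).
Proof.
move=> i j ij; apply/subsetPset => z [yz zt]; split => //.
by apply: (lt_le_trans zt); rewrite lee_fin t_nd.
Qed.

Lemma bigcup_oo_left : oo u x%:E = \bigcup_n oo (s n)%:E x%:E.
Proof.
apply/seteqP; split => z [].
  by move=> uz zx; have [n sz] := s_ex uz; exists n => //; split.
move=> n _ [sz zx]; split => //; apply: lt_trans sz.
by have [] := us n.
Qed.

Lemma bigcup_oo_right : oo y%:E v = \bigcup_n oo y%:E (t n)%:E.
Proof.
apply/seteqP; split => z [].
  by move=> yz zv; have [n zt] := t_ex zv; exists n => //; split.
move=> n _ [yz zt]; split => //; apply: (lt_trans zt).
by have [] := tv n.
Qed.
End exhaustion_oo.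

Section kappa_limit.
Context {R : realType} (m p : {measure set (measurableTypeR R) -> \bar R}).
Context (u v : \bar R) (x y : R) (s t : nat -> R).
Hypotheses (xy : x < y) (ux : (u < x%:E)%E) (yv : (y%:E < v)%E).
Hypotheses (s_ni : nonincreasing_seq s) (t_nd : nondecreasing_seq t).
Hypotheses (us : forall n, (u < (s n)%:E)%E /\ s n < x).
Hypotheses (tv : forall n, ((t n)%:E < v)%E /\ y < t n).
Hypotheses (s_ex : forall z : R, (u < z%:E)%E -> exists n, s n < z).
Hypotheses (t_ex : forall z : R, (z%:E < v)%E -> exists n, z < t n).
Hypotheses (m_set1 : forall z, m [set z] = 0%E).
Hypotheses (m_lty : forall c d : R, (u < c%:E)%E -> (d%:E < v)%E ->
  (m (oo c%:E d%:E) < +oo)%E).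
Hypotheses (m_gt0 : forall c d : R, (u < c%:E)%E -> (d%:E < v)%E -> c < d ->
  (0 < m (oo c%:E d%:E))%E).
Hypothesis (p_gt0 : (0 < p (oo x%:E y%:E))%E).

Local Notation S1 := (oo u x%:E).
Local Notation S2 := (oo y%:E v).
Let I n := oo (s n)%:E x%:E.
Let J n := oo y%:E (t n)%:E.
Let r1 z := fine (m (oo z%:E x%:E)).
Let r2 z := fine (m (oo y%:E z%:E)).

Let xv : (x%:E < v)%E. Proof. by apply: lt_trans yv; rewrite lte_fin. Qed.
Let uy : (u < y%:E)%E. Proof. by apply: lt_trans ux _; rewrite lte_fin. Qed.

Let I_nd : nondecreasing_seq (I : nat -> set (measurableTypeR R)).
Proof. exact: nondecreasing_oo_left. Qed.

Let J_nd : nondecreasing_seq (J : nat -> set (measurableTypeR R)).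
Proof. exact: nondecreasing_oo_right. Qed.

Let I_U : S1 = \bigcup_n I n. Proof. exact: bigcup_oo_left. Qed.

Let J_U : S2 = \bigcup_n J n. Proof. exact: bigcup_oo_right. Qed.

Let mI n : measurable (I n : set (measurableTypeR R)). Proof. exact: measurable_oo. Qed.
Let mJ n : measurable (J n : set (measurableTypeR R)). Proof. exact: measurable_oo. Qed.
Let I_lty n : (m (I n) < +oo)%E. Proof. by apply: m_lty => //; have [] := us n. Qed.
Let J_lty n : (m (J n) < +oo)%E. Proof. by apply: m_lty => //; have [] := tv n. Qed.
Let I_gt0 n : (0 < m (I n))%E. Proof. by have [? ?] := us n; apply: m_gt0. Qed.
Let J_gt0 n : (0 < m (J n))%E. Proof. by have [? ?] := tv n; apply: m_gt0. Qed.

Let mr1 n : measurable_fun (I n) r1.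
Proof.
have T := measurable_trapezoid (I_gt0 n) (I_lty n) (J_gt0 n) (J_lty n) (mI n).
apply: (@eq_measurable_fun _ _ _ _ _
  (fun z => (1 - trapezoid m (s n)%:E (t n)%:E x y z) * fine (m (I n)))).
  move=> z; rewrite inE => Iz.
  rewrite (trapezoid_left _ xy (I_gt0 n) (I_lty n) Iz).
  have : fine (m (I n)) != 0 by rewrite gt_eqF// fine_gt0// I_gt0 I_lty.
  by rewrite /r1 /I => n0; field.
by apply: measurable_funM => //; apply: measurable_funB.
Qed.

Let mr2 n : measurable_fun (J n) r2.
Proof.
have T := measurable_trapezoid (I_gt0 n) (I_lty n) (J_gt0 n) (J_lty n) (mJ n).
apply: (@eq_measurable_fun _ _ _ _ _
  (fun z => (1 - trapezoid m (s n)%:E (t n)%:E x y z) * fine (m (J n)))).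
  move=> z; rewrite inE => Jz.
  rewrite (trapezoid_right m_set1 xy (I_gt0 n) (I_lty n) Jz).
  have : fine (m (J n)) != 0 by rewrite gt_eqF// fine_gt0// J_gt0 J_lty.
  by rewrite /r2 /J => n0; field.
by apply: measurable_funM => //; apply: measurable_funB.
Qed.

Let S1_gt0 : (0 < m S1)%E.
Proof.
apply: lt_le_trans (I_gt0 0) _; apply: le_measure; rewrite ?inE//.
  exact: measurable_oo.
by rewrite I_U; exact: (bigcup_sup (i := 0%N)).
Qed.

Let S2_gt0 : (0 < m S2)%E.
Proof.
apply: lt_le_trans (J_gt0 0) _; apply: le_measure; rewrite ?inE//.
  exact: measurable_oo.
by rewrite J_U; exact: (bigcup_sup (i := 0%N)).
Qed.

(** The coefficients c n and d n are reciprocal masses. They are those of I n and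
    J n when the trial function must have compact support, and constantly those
    of the whole sides when it need not. *)
Lemma le_kappa_bar (l : \bar R) (c d : nat -> R) :
  nonincreasing_seq c -> nonincreasing_seq d ->
  c n @[n --> \oo] --> (fine (m S1))^-1 ->
  d n @[n --> \oo] --> (fine (m S2))^-1 ->
  (forall n, 0 <= c n <= (fine (m (I n)))^-1) ->
  (forall n, 0 <= d n <= (fine (m (J n)))^-1) ->
  (forall n V, 0 < V ->
    (V%:E <= p (oo x%:E y%:E)
      + \int[p]_(z in I n) (((1 - r1 z * c n) ^+ 2)%R)%:E
      + \int[p]_(z in J n) (((1 - r2 z * d n) ^+ 2)%R)%:E)%E ->
    (l <= ((c n + d n) / V)%:E)%E) ->
  (l <= ((m S1)^-1 + (m (co y%:E v))^-1) *
    (p (oo x%:E y%:E)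
     + \int[p]_(z in S1) (1 - m (oo z%:E x%:E) / m S1) ^+ 2
     + \int[p]_(z in S2) (1 - m (oo y%:E z%:E) / m S2) ^+ 2)^-1)%E.
Proof.
move=> c_ni d_ni cC dC cI dJ H.
have -> : m (co y%:E v) = m S2.
  rewrite (_ : co _ _ = S2 `|` [set y]).
    by rewrite measureU0//; exact: measurable_oo.
  apply/seteqP; split => z.
    move=> [+ zv]; rewrite lee_fin le_eqVlt => /predU1P[->|yz]; [by right|left].
    by split.
  by move=> [[/ltW yz zv]|->]; split => //; exact: lexx.
have S1V := inve_gt0_EFin S1_gt0; have S2V := inve_gt0_EFin S2_gt0.
rewrite [X in (p _ + X)%E](_ : _ =
    \int[p]_(z in S1) (((1 - r1 z * (fine (m S1))^-1) ^+ 2)%R)%:E)%E; last first.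
  apply: eq_integral => z; rewrite inE => -[uz zx].
  by rewrite S1V -(@fineK _ (m (oo z%:E x%:E))) ?ge0_fin_numE ?m_lty//.
rewrite [X in (_ + X)^-1%E](_ : _ =
    \int[p]_(z in S2) (((1 - r2 z * (fine (m S2))^-1) ^+ 2)%R)%:E)%E; last first.
  apply: eq_integral => z; rewrite inE => -[yz zv].
  by rewrite S2V -(@fineK _ (m (oo y%:E z%:E))) ?ge0_fin_numE ?m_lty//.
rewrite S1V S2V -EFinD.
have fine_pos (X : \bar R) : (0 <= X)%E -> 0 <= (fine X)^-1.
  by move=> X0; rewrite invr_ge0 fine_ge0.
have rle (S : set (measurableTypeR R)) (A : set (measurableTypeR R)) e :
    measurable S -> measurable A -> A `<=` S -> (0 < m S)%E -> (m S < +oo)%E ->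
    0 <= e <= (fine (m S))^-1 -> fine (m A) * e <= 1.
  move=> mS mA AS S0 Soo /andP[e0 eS].
  have f0 : 0 < fine (m S) by rewrite fine_gt0// S0.
  have mAS : (m A <= m S)%E by apply: le_measure; rewrite ?inE.
  apply: (@le_trans _ _ (fine (m S) * (fine (m S))^-1)); last first.
    by rewrite divff// gt_eqF.
  rewrite ler_pM ?fine_ge0// fine_le// ge0_fin_numE//.
  exact: le_lt_trans Soo.
have rc1 n z : I n z -> r1 z * c n <= 1.
  move=> [sz _]; apply: (rle (I n)) => //; first exact: measurable_oo.
  by move=> w [zw wx]; split => //; exact: lt_trans sz zw.
have rc2 n z : J n z -> r2 z * d n <= 1.
  move=> [_ zt]; apply: (rle (J n)) => //; first exact: measurable_oo.
  by move=> w [yw wz]; split => //; exact: lt_trans wz zt.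
have r1_ge0 z : 0 <= r1 z by exact: fine_ge0.
have r2_ge0 z : 0 <= r2 z by exact: fine_ge0.
have cvI := cvg_side_integral mI I_nd I_U mr1 r1_ge0 c_ni cC rc1 (p := p).
have cvJ := cvg_side_integral mJ J_nd J_U mr2 r2_ge0 d_ni dC rc2 (p := p).
set B := (p _ + _ + _)%E.
have int0 (q : {measure set (measurableTypeR R) -> \bar R}) (A : set R)
    (g : R -> R) :
    (0 <= \int[q]_(z in A) (((g z) ^+ 2)%R)%:E)%E.
  by apply: integral_ge0 => z _; rewrite lee_fin sqr_ge0.
have cvB : (p (oo x%:E y%:E)
      + \int[p]_(z in I n) (((1 - r1 z * c n) ^+ 2)%R)%:E
      + \int[p]_(z in J n) (((1 - r2 z * d n) ^+ 2)%R)%:E)%E @[n --> \oo] --> B.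
  apply: cvgeD cvJ.
    by rewrite ge0_adde_def// inE// adde_ge0.
  apply: cvgeD cvI; last exact: cvg_cst.
  by rewrite ge0_adde_def// inE.
apply: ratio_le_limit.
- by rewrite addr_ge0// fine_pos.
- rewrite /B -addeA; apply: (lt_le_trans p_gt0); apply: leeDl.
  by rewrite adde_ge0.
move=> e V Ae V0 VB.
near \oo => n.
have cde : c n + d n < e.
  near: n; apply: (cvgr_lt _ _ _ Ae).
  exact: cvgD.
have VBn : (V%:E < p (oo x%:E y%:E)
      + \int[p]_(z in I n) (((1 - r1 z * c n) ^+ 2)%R)%:E
      + \int[p]_(z in J n) (((1 - r2 z * d n) ^+ 2)%R)%:E)%E.
  near: n; have /cvB : nbhs B [set z | (V%:E < z)%E].
    by apply: open_nbhs_nbhs; split => //; exact: open_ereal_gt_ereal.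
  exact.
apply: le_trans (H n V V0 (ltW VBn)) _.
by rewrite lee_fin; apply: ler_wpM2r; [rewrite invr_ge0|]; exact: ltW.
Unshelve. all: by end_near. Qed.
End kappa_limit.

(** * The two chains of inequalities *)

(** If the limit is infinite, its [fine] is 0 and so is the inverse of that: the
    convention 1 / +oo = 0. *)
Lemma cvg_inv_fine {R : realType} (X : nat -> \bar R) (L : \bar R) :
  (forall n, 0 < X n)%E -> (forall n, X n < +oo)%E -> (0 < L)%E ->
  X n @[n --> \oo] --> L -> (fine (X n))^-1 @[n --> \oo] --> (fine L)^-1.
Proof.
move=> X0 Xoo L0 XL.
have fX0 n : 0 < fine (X n) by rewrite fine_gt0// X0 Xoo.
have [Loo|Lfin] := eqVneq L +oo%E; last first.
  have Lf : L \is a fin_num by rewrite ge0_fin_numE ?ltW// ltey.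
  apply: cvgV; first by rewrite gt_eqF// fine_gt0// L0 ltey.
  by apply: fine_cvg; rewrite fineK.
rewrite Loo /= invr0; apply/cvgrPdist_lt => eps eps0; near=> n.
rewrite sub0r normrN gtr0_norm ?invr_gt0// invf_plt ?posrE//.
rewrite -lte_fin fineK; last by rewrite ge0_fin_numE ?ltW.
near: n; have /XL : nbhs L [set z | ((eps^-1)%:E < z)%E].
  apply: open_nbhs_nbhs; split; first exact: open_ereal_gt_ereal.
  by rewrite /= Loo ltry.
exact.
Unshelve. all: by end_near. Qed.

Lemma measurable_co {R : realType} (u v : \bar R) :
  measurable (co u v : set (measurableTypeR R)).
Proof.
rewrite (_ : co u v = ~` oo -oo%E u `&` oo -oo%E v).
  by apply: measurableI; [apply: measurableC|]; exact: measurable_oo.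
apply/seteqP; split => z.
  move=> [uz zv]; split; last by split => //; rewrite ltNyr.
  by move=> [_]; apply/negP; rewrite -leNgt.
move=> [zu [_ zv]]; split => //; rewrite leNgt; apply/negP => uz.
by apply: zu; split => //; rewrite ltNyr.
Qed.

Lemma kappa_bar_le_kappa {R : realType} (M N : \bar R)
  (m p : {measure set (measurableTypeR R) -> \bar R}) :
  (kappa_bar_inv M N p m <= kappa_inv M N p m)%E.
Proof.
apply: le_ereal_inf_tmp => _ [x [y [Mx xy yN ->]]].
apply: ge_ereal_inf; eexists; first by exists x, y; split.
have inv_ge0 (A : set (measurableTypeR R))
    (q : {measure set (measurableTypeR R) -> \bar R}) : (0 <= (q A)^-1)%E.
  by rewrite inve_ge0.
have sq_ge0 (A : set R) (g : R -> \bar R) : (0 <= \int[p]_(z in A) (g z) ^+ 2)%E.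
  by apply: integral_ge0 => z _; exact: sqre_ge0.
have B_ge : (p (oo x%:E y%:E) <= p (oo x%:E y%:E)
    + \int[p]_(z in oo (- M) x%:E) (1 - m (oo z%:E x%:E) / m (oo (- M) x%:E)) ^+ 2
    + \int[p]_(z in oo y%:E N) (1 - m (oo y%:E z%:E) / m (oo y%:E N)) ^+ 2)%E.
  by rewrite -addeA; apply: leeDl; exact: adde_ge0.
apply: lee_pmul.
- exact: adde_ge0.
- by rewrite inve_ge0; apply: le_trans B_ge.
- apply: leeD2l; rewrite lee_pV2 ?inE//; apply: le_measure; rewrite ?inE.
  + exact: measurable_oo.
  + exact: measurable_co.
  + by move=> z [/ltW yz zN]; split.
- by rewrite lee_pV2 ?inE//; apply: le_trans B_ge.
Qed.

Section drift_continuous.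
Context {R : realType} (D : set R) (a b : R -> R).
Hypotheses (oD : open D) (a_gt0 : forall z, D z -> 0 < a z).
Hypotheses (ca : {within D, continuous a}) (cb : {within D, continuous b}).

Let ca' z : D z -> {for z, continuous a}.
Proof.
move=> Dz; move: ca; rewrite continuous_open_subspace// => /(_ z); apply.
by rewrite inE.
Qed.

Let cb' z : D z -> {for z, continuous b}.
Proof.
move=> Dz; move: cb; rewrite continuous_open_subspace// => /(_ z); apply.
by rewrite inE.
Qed.

Lemma measurable_within_continuous : measurable_fun D a.
Proof.
apply: open_continuous_measurable_fun => // z; rewrite inE; exact: ca'.
Qed.

Lemma locally_integrable_ratio : locally_integrable D (fun u => b u / a u).
Proof.
have cf : {in D, continuous (fun u => b u / a u)}.
  move=> z; rewrite inE => Dz; apply: (cvgM (cb' Dz)).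
  by apply: cvgV; [rewrite gt_eqF// a_gt0|exact: ca'].
split => //; first exact: open_continuous_measurable_fun.
move=> K KD cK.
have : lebesgue_measure.-integrable K (EFin \o (fun u => b u / a u)).
  apply: continuous_compact_integrable => //.
  apply: continuous_in_subspaceT => z; rewrite inE => /KD Dz.
  by apply: cf; rewrite inE.
by move=> /integrableP[].
Qed.
End drift_continuous.

Section diffusion.
Context (R : realType) (M N : \bar R) (a b : R -> R) (x0 : R).
Local Notation D := (oo (- M)%E N).
Context (mu nu : {measure set (measurableTypeR R) -> \bar R}).
Hypotheses (a_gt0 : forall x, D x -> 0 < a x) (Dx0 : D x0).
Hypotheses (mu_speed : speed_measure M N a b x0 mu).
Hypotheses (nu_scale : scale_measure M N a b x0 nu).
Hypotheses (ma : measurable_fun D a).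
Hypothesis lif : locally_integrable D (fun u => b u / a u).

Let oo_sub (c d : R) : (- M < c%:E)%E -> (d%:E < N)%E -> oo c%:E d%:E `<=` D.
Proof.
by move=> Mc dN z [cz zd]; split; [exact: lt_trans cz|exact: lt_trans dN].
Qed.

Let itv_sub (c d : R) : (- M < c%:E)%E -> (d%:E < N)%E ->
  `]c, d[ `<=` oo c%:E d%:E `&` D.
Proof.
move=> Mc dN z /=; rewrite in_itv/= => /andP[cz zd].
have cdz : oo c%:E d%:E z by split; rewrite lte_fin.
by split => //; exact: (oo_sub Mc dN).
Qed.

Lemma scale_measure_gt0 (c d : R) : (- M < c%:E)%E -> (d%:E < N)%E -> c < d ->
  (0 < nu (oo c%:E d%:E))%E.
Proof.
move=> Mc dN cd; apply: (density_gt0 (measurable_oo _ _)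
  (measurable_scale_density Dx0 lif) _ nu_scale (measurable_oo _ _) cd).
  by move=> z _; exact: scale_density_gt0.
exact: itv_sub.
Qed.

Lemma speed_measure_gt0 (c d : R) : (- M < c%:E)%E -> (d%:E < N)%E -> c < d ->
  (0 < mu (oo c%:E d%:E))%E.
Proof.
move=> Mc dN cd; apply: (density_gt0 (measurable_oo _ _)
  (measurable_speed_density Dx0 lif ma a_gt0) _ mu_speed (measurable_oo _ _) cd).
  by move=> z Dz; rewrite divr_gt0 ?expR_gt0// a_gt0.
exact: itv_sub.
Qed.

(** The reciprocal masses c n decrease to the reciprocal mass of the whole side,
    which is 0 if nu is infinite there. *)
Lemma lambdaDD_le_kappa_bar : locally_finite_on D mu -> locally_finite_on D nu ->
  (lambdaDD M N a b x0 mu <= kappaDD_bar_inv M N mu nu)%E.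
Proof.
move=> mu_fin nu_fin; apply: le_ereal_inf_tmp => _ [x [y [Mx xy yN ->]]].
have [s [s_ni sM s_ex]] := exhaust_left Mx.
have [t [t_nd tN t_ex]] := exhaust_right yN.
have nu_lty c d : (- M < c%:E)%E -> (d%:E < N)%E -> (nu (oo c%:E d%:E) < +oo)%E.
  move=> Mc dN; have [cd|dc] := ltP c d; last first.
    rewrite (_ : oo _ _ = set0) ?measure0 ?ltry//.
    apply/seteqP; split => // z [cz zd]; have := lt_trans cz zd.
    by rewrite lte_fin ltNge dc.
  have Dc : D c by split => //; apply: lt_trans dN; rewrite lte_fin.
  have Dd : D d by split => //; apply: (lt_trans Mc); rewrite lte_fin.
  apply: (@le_lt_trans _ _ (nu `[c, d]%classic)).
    apply: le_measure; rewrite ?inE//; first exact: measurable_oo.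
    by move=> z []; rewrite !lte_fin /= in_itv/= => /ltW-> /ltW->.
  by apply: nu_fin; [exact: segment_compact|exact: subset_itv_oo].
have Ds n : D (s n).
  have [Ms sx] := sM n; split => //; apply: lt_trans yN.
  by rewrite lte_fin (lt_trans sx).
have Dt n : D (t n).
  have [tN' yt] := tN n; split => //; apply: (lt_trans Mx).
  by rewrite lte_fin (lt_trans xy).
have I_lty n : (nu (oo (s n)%:E x%:E) < +oo)%E.
  by apply: nu_lty; [have [] := sM n|apply: lt_trans yN; rewrite lte_fin].
have J_lty n : (nu (oo y%:E (t n)%:E) < +oo)%E.
  by apply: nu_lty; [apply: (lt_trans Mx); rewrite lte_fin|have [] := tN n].
have I_gt0 n : (0 < nu (oo (s n)%:E x%:E))%E.
  have [Ms sx] := sM n; apply: scale_measure_gt0 => //.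
  by apply: lt_trans yN; rewrite lte_fin.
have J_gt0 n : (0 < nu (oo y%:E (t n)%:E))%E.
  have [tN' yt] := tN n; apply: scale_measure_gt0 => //.
  by apply: (lt_trans Mx); rewrite lte_fin.
have inv_ni (S : nat -> set (measurableTypeR R)) :
    (forall n, measurable (S n)) -> nondecreasing_seq S ->
    (forall n, 0 < nu (S n))%E -> (forall n, nu (S n) < +oo)%E ->
    nonincreasing_seq (fun n => (fine (nu (S n)))^-1).
  move=> mS ndS S0 Soo i j ij.
  rewrite lef_pV2 ?posrE ?fine_gt0 ?S0 ?Soo// fine_le ?ge0_fin_numE//.
  by apply: le_measure; rewrite ?inE//; apply/subsetPset; exact: ndS.
have I_nd := nondecreasing_oo_left x s_ni.
have J_nd := nondecreasing_oo_right y t_nd.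
have I_U := bigcup_oo_left sM s_ex.
have J_U := bigcup_oo_right tN t_ex.
have S1_gt0 : (0 < nu (oo (- M) x%:E))%E.
  apply: lt_le_trans (I_gt0 0%N) _; apply: le_measure; rewrite ?inE;
    try exact: measurable_oo.
  by rewrite I_U; exact: (bigcup_sup (i := 0%N)).
have S2_gt0 : (0 < nu (oo y%:E N))%E.
  apply: lt_le_trans (J_gt0 0%N) _; apply: le_measure; rewrite ?inE;
    try exact: measurable_oo.
  by rewrite J_U; exact: (bigcup_sup (i := 0%N)).
apply: (le_kappa_bar xy Mx yN s_ni t_nd sM tN s_ex t_ex _ nu_lty
  scale_measure_gt0 _
  (c := fun n => (fine (nu (oo (s n)%:E x%:E)))^-1)
  (d := fun n => (fine (nu (oo y%:E (t n)%:E)))^-1)).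
- exact: density_set1 nu_scale.
- by apply: speed_measure_gt0.
- by apply: inv_ni => // n; exact: measurable_oo.
- by apply: inv_ni => // n; exact: measurable_oo.
- apply: cvg_inv_fine => //; rewrite I_U; apply: nondecreasing_cvg_mu => //.
    by move=> n; exact: measurable_oo.
  by rewrite -I_U; exact: measurable_oo.
- apply: cvg_inv_fine => //; rewrite J_U; apply: nondecreasing_cvg_mu => //.
    by move=> n; exact: measurable_oo.
  by rewrite -J_U; exact: measurable_oo.
- by move=> n; rewrite lexx andbT invr_ge0 fine_ge0.
- by move=> n; rewrite lexx andbT invr_ge0 fine_ge0.
move=> n V V0; have [[_ sx] [_ yt]] := (sM n, tN n).
exact: (lambdaDD_le Dx0 lif nu_scale mu_fin nu_fin (Ds n) (Dt n)).
Qed.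

(** Only the cutoff of the derivative moves to the end points: the trapezoid of mu
    on the whole sides exists because mu is finite. *)
Lemma lambdaNN_le_kappa_bar : (mu D < +oo)%E ->
  (lambdaNN M N a b x0 mu <= kappaNN_bar_inv M N mu nu)%E.
Proof.
move=> muD_lty; apply: le_ereal_inf_tmp => _ [x [y [Mx xy yN ->]]].
have mu_lty : (mu setT < +oo)%E.
  rewrite -(density_restrict (measurable_oo _ _) mu_speed)//.
  by rewrite setTI.
have mu_fin (A : set (measurableTypeR R)) : measurable A -> (mu A < +oo)%E.
  by move=> mA; apply: le_lt_trans mu_lty; apply: le_measure; rewrite ?inE.
have [s [s_ni sM s_ex]] := exhaust_left Mx.
have [t [t_nd tN t_ex]] := exhaust_right yN.
have Ds n : D (s n).
  have [Ms sx] := sM n; split => //; apply: lt_trans yN.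
  by rewrite lte_fin (lt_trans sx).
have Dt n : D (t n).
  have [tN' yt] := tN n; split => //; apply: (lt_trans Mx).
  by rewrite lte_fin (lt_trans xy).
have I_gt0 n : (0 < mu (oo (s n)%:E x%:E))%E.
  have [Ms sx] := sM n; apply: speed_measure_gt0 => //.
  by apply: lt_trans yN; rewrite lte_fin.
have J_gt0 n : (0 < mu (oo y%:E (t n)%:E))%E.
  have [tN' yt] := tN n; apply: speed_measure_gt0 => //.
  by apply: (lt_trans Mx); rewrite lte_fin.
have I_S1 n : (mu (oo (s n)%:E x%:E) <= mu (oo (- M) x%:E))%E.
  apply: le_measure; rewrite ?inE; try exact: measurable_oo.
  by rewrite (bigcup_oo_left sM s_ex); exact: (bigcup_sup (i := n)).
have J_S2 n : (mu (oo y%:E (t n)%:E) <= mu (oo y%:E N))%E.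
  apply: le_measure; rewrite ?inE; try exact: measurable_oo.
  by rewrite (bigcup_oo_right tN t_ex); exact: (bigcup_sup (i := n)).
have S1_gt0 := lt_le_trans (I_gt0 0%N) (I_S1 0%N).
have S2_gt0 := lt_le_trans (J_gt0 0%N) (J_S2 0%N).
have inv_le (A B : \bar R) : (0 < A)%E -> (A <= B)%E -> (B < +oo)%E ->
    0 <= (fine B)^-1 <= (fine A)^-1.
  move=> A0 AB Boo; have Aoo := le_lt_trans AB Boo.
  have B0 := lt_le_trans A0 AB.
  rewrite invr_ge0 fine_ge0 ?(ltW B0)//= lef_pV2 ?posrE ?fine_gt0 ?A0 ?B0//.
  by rewrite fine_le// ge0_fin_numE// ltW.
have mu_set1 := density_set1 mu_speed.
apply: (le_kappa_bar xy Mx yN s_ni t_nd sM tN s_ex t_ex mu_set1 _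
  speed_measure_gt0 _
  (c := fun=> (fine (mu (oo (- M) x%:E)))^-1)
  (d := fun=> (fine (mu (oo y%:E N)))^-1)).
- by move=> c d _ _; apply: mu_fin; exact: measurable_oo.
- exact: scale_measure_gt0.
- by [].
- by [].
- exact: cvg_cst.
- exact: cvg_cst.
- by move=> n; apply: inv_le => //; apply: mu_fin; exact: measurable_oo.
- by move=> n; apply: inv_le => //; apply: mu_fin; exact: measurable_oo.
move=> n V V0; have [[_ sx] [_ yt]] := (sM n, tN n).
exact: (lambdaNN_le Dx0 lif nu_scale mu_lty mu_set1 (Ds n) (Dt n)).
Qed.
End diffusion.

Theorem proposition4p1 (R : realType) (M N : \bar R)
  (M_gt0 : (0 < M)%E) (N_gt0 : (0 < N)%E)
  (a b : R -> R) (a_gt0 : forall x, oo (- M)%E N x -> 0 < a x)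
  (x0 : R) (x0_in : oo (- M)%E N x0)
  (mu nu : {measure set (measurableTypeR R) -> \bar R})
  (mu_speed : speed_measure M N a b x0 mu)
  (nu_scale : scale_measure M N a b x0 nu) :
  (measurable_fun (oo (- M)%E N) a ->
   locally_integrable (oo (- M)%E N) (fun u => b u / a u) ->
   locally_finite_on (oo (- M)%E N) mu ->
   locally_finite_on (oo (- M)%E N) nu ->
   (lambdaDD M N a b x0 mu <= kappaDD_bar_inv M N mu nu)%E /\
   (kappaDD_bar_inv M N mu nu <= kappaDD_inv M N mu nu)%E)
  /\
  ({within oo (- M)%E N, continuous a} ->
   {within oo (- M)%E N, continuous b} ->
   (mu (oo (- M)%E N) < +oo)%E ->
   (lambdaNN M N a b x0 mu <= kappaNN_bar_inv M N mu nu)%E /\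
   (kappaNN_bar_inv M N mu nu <= kappaNN_inv M N mu nu)%E).
Proof.
split.
  move=> ma lif mu_fin nu_fin; split; last exact: kappa_bar_le_kappa.
  exact: lambdaDD_le_kappa_bar.
move=> ca cb mu_lty; split; last exact: kappa_bar_le_kappa.
have oD := @open_oo R (- M)%E N.
apply: lambdaNN_le_kappa_bar => //.
  exact: measurable_within_continuous.
exact: locally_integrable_ratio.
Qed.
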